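(* Let $n\ge 2$, let $X_1,\ldots,X_n$ be independent copies of a real random variable $X$, and let $\mu_1,\ldots,\mu_n$ be distinct positive real numbers. Let $\varphi(t)=E(e^{itX})$, $t\in\mathbb{R}$, be the characteristic function of $X$, and suppose that $\varphi$ is infinitely differentiable at $0$ and that $$\prod_{k=1}^n \varphi(\mu_k t)=\sum_{k=1}^n \theta_k\,\varphi(\mu_k t)\qquad\text{for all } t\in\mathbb{R},$$ where $\theta_k=\prod_{j=1,\,j\neq k}^n \frac{\mu_k^2}{\mu_k^2-\mu_j^2}$ for $k=1,\ldots,n$. Then either $P(X=0)=1$ or $X$ has a Laplace distribution.
   Context: A random variable $X$ has a Laplace (double exponential) distribution if there is $\lambda>0$ such that $P(X>x)=\frac{\lambda}{2}\int_x^\infty e^{-\lambda|y|}\,dy$ for all $x\in\mathbb{R}$; equivalently, its characteristic function is $\frac12\big(\frac{\lambda}{\lambda-it}+\frac{\lambda}{\lambda+it}\big)=\frac{\lambda^2}{\lambda^2+t^2}$. *)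

(* Defs.v *)
From HB Require Import structures.
From mathcomp Require Import all_boot all_order all_algebra.
From mathcomp Require Import all_classical all_reals all_analysis.
From mathcomp Require Import complex.
Set Implicit Arguments. Unset Strict Implicit. Unset Printing Implicit Defensive.
Import Order.TTheory GRing.Theory Num.Theory.
Import numFieldNormedType.Exports.
Local Open Scope classical_set_scope.
Local Open Scope ring_scope.

Definition charfun d (T : measurableType d) (R : realType)
  (P : probability T R) (X : {RV P >-> R}) (t : R) : R[i] :=
  Complex (fine 'E_P[fun w => cos (t * X w)]%E)
          (fine 'E_P[fun w => sin (t * X w)]%E).

(* f : R -> R is infinitely differentiable at 0: every derivative f^(k)
   exists at 0 (equivalently, each f^(k) is differentiable in a
   neighbourhood of 0). *)
Definition smooth_at0 (R : realType) (f : R -> R) : Prop :=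
  forall k : nat, \forall x \near (0:R), derivable (derive1n k f) x 1.

Definition csmooth_at0 (R : realType) (f : R -> R[i]) : Prop :=
  smooth_at0 (fun t => complex.Re (f t)) /\ smooth_at0 (fun t => complex.Im (f t)).

Definition theta (R : realType) (n : nat) (mu : 'I_n -> R) (k : 'I_n) : R :=
  \prod_(j < n | j != k) (mu k ^+ 2 / (mu k ^+ 2 - mu j ^+ 2)).

Definition is_laplace d (T : measurableType d) (R : realType)
  (P : probability T R) (X : {RV P >-> R}) : Prop :=
  exists lam : R, 0 < lam /\
    forall x : R, P [set w | x < X w] =
      ((lam / 2)%:E * \int[lebesgue_measure]_(y in `]x, +oo[) (expR (- (lam * `|y|)))%:E)%E.

(* Main.v *)
(** Let [a_j = i^j E X^j / j!].  Smoothness of [phi] at 0 makes all moments of [X]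
    finite: if [E X^(2k)] is finite, comparing the Taylor expansion of [phi] with the
    alternating Taylor remainders of [cos] gives
    [E (-1)^(k+1) (cos tX - T_k(tX)) = O(t^(2k+2))], and Fatou's lemma bounds
    [E X^(2k+2)].  The coefficient of [t^m] in the functional equation is then
    [a_m (sum_k theta_k mu_k^m - sum_k mu_k^m)] plus terms in [a_j], [j < m].  The
    factor vanishes only for [m = 2]: [sum_k theta_k mu_k^m] is a divided difference in
    the nodes [mu_k^2], is smaller than [sum_k mu_k] for [m = 1] and larger than
    [sum_k mu_k^m] for [m >= 3].  As [1 / (1 + c t^2)] solves the same equation (partial
    fractions), [X] has the moments of a Laplace variable, or [E X^2 = 0].

    These moments determine the distribution.  They grow like [m! / lam^m], so Taylor
    expansion transports the equality of all [E X^j cos(tX)] and [E X^j sin(tX)] from [t]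
    to [t + s] with [s] bounded below, hence from 0 to every [t].  So the expectations of
    polynomials in [sin(s(X - b))] agree; bounded limits of these are the indicators of
    [sin(s(X - b)) > 0], and [s -> 0] yields the indicator of [X > b]. *)

Require Import Defs.
From HB Require Import structures.
From mathcomp Require Import all_boot all_order all_algebra.
From mathcomp Require Import all_classical all_reals all_analysis.
From mathcomp Require Import complex.
From mathcomp Require Import measurable_realfun ring lra.
Import Order.TTheory GRing.Theory Num.Theory.
Import numFieldNormedType.Exports.
Local Open Scope classical_set_scope.
Local Open Scope ring_scope.
Set Implicit Arguments.
Unset Strict Implicit.
Unset Printing Implicit Defensive.

(** * Derivatives of finite sums, continuity and monotonicity *)

Lemma is_derive_bigsum {R : realType} (I : Type) (r : seq I) (P : pred I)
    (f : I -> R -> R) (df : I -> R) (x : R) :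
  (forall i, P i -> is_derive x 1 (f i) (df i)) ->
  is_derive x 1 (fun y => \sum_(i <- r | P i) f i y) (\sum_(i <- r | P i) df i).
Proof.
move=> h; rewrite (_ : (fun y => _) = \sum_(i <- r | P i) f i).
  by elim/big_ind2 : _ => // [|] *; [exact: is_derive_cst|exact: is_deriveD].
by apply/funext => y; rewrite fct_sumE.
Qed.

Lemma is_derive_continuous {R : realType} (F dF : R -> R) :
  (forall x : R, is_derive x 1 F (dF x)) -> continuous F.
Proof.
move=> dF_ x; apply/differentiable_continuous/derivable1_diffP.
by have [] := dF_ x.
Qed.

Lemma derive_ge0_incr {R : realType} (F dF : R -> R) :
  (forall x : R, is_derive x 1 F (dF x)) -> (forall x, 0 < x -> 0 <= dF x) ->
  forall x y, 0 <= x -> x <= y -> F x <= F y.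
Proof.
move=> dF_ dF0 x y x0 xy; apply: (@ger0_derive1_ndecry _ F 0) => //.
- move=> z; rewrite in_itv/= andbT => z0.
  by rewrite derive1E (@derive_val _ _ _ _ _ _ _ (dF_ z)) dF0.
- exact: continuous_subspaceT (is_derive_continuous dF_).
Qed.


(** * Alternating Taylor bounds for sine and cosine *)

Section TrigTaylor.
Context {R : realType}.
Implicit Types (k : nat) (x : R).

Definition cosT k x : R := \sum_(j < k) (-1) ^+ j * x ^+ j.*2 / (j.*2)`!%:R.
Definition sinT k x : R := \sum_(j < k) (-1) ^+ j * x ^+ j.*2.+1 / (j.*2.+1)`!%:R.

Let is_derive_monom (a : R) m x :
  is_derive x 1 (fun y : R => a * y ^+ m.+1 / (m.+1)`!%:R) (a * x ^+ m / m`!%:R).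
Proof.
have -> : (fun y : R => a * y ^+ m.+1 / (m.+1)`!%:R) =
    horner ((a / (m.+1)`!%:R) *: 'X^(m.+1)).
  by apply/funext => y; rewrite hornerZ hornerXn; ring.
apply: trigger_derive; rewrite derivZ derivXn hornerZ hornerMn hornerXn/=.
rewrite factS natrM -mulr_natr; field.
by rewrite -(natrD _ 1) !pnatr_eq0 -!lt0n fact_gt0.
Qed.

Lemma is_derive_sinT k x : is_derive x 1 (sinT k) (cosT k x).
Proof. by apply: is_derive_bigsum => j _; exact: is_derive_monom. Qed.

Lemma is_derive_cosT k x : is_derive x 1 (cosT k.+1) (- sinT k x).
Proof.
rewrite (_ : cosT k.+1 = cst 1 + (fun y =>
   \sum_(j < k) (-1) ^+ j.+1 * y ^+ j.*2.+2 / (j.*2.+2)`!%:R)); last first.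
  apply/funext => y; rewrite /cosT big_ord_recl/= expr0 mulr1 fact0 divr1.
  by congr (_ + _).
rewrite -[X in is_derive _ _ _ X]add0r; apply: is_deriveD.
rewrite /sinT -sumrN; apply: is_derive_bigsum => j _.
have := is_derive_monom ((-1) ^+ j.+1) (j.*2.+1) x.
by rewrite exprS !mulN1r !mulNr.
Qed.

Lemma cosTS k x : cosT k.+1 x = cosT k x + (-1) ^+ k * x ^+ k.*2 / (k.*2)`!%:R.
Proof. by rewrite /cosT big_ord_recr. Qed.

Lemma sinTS k x : sinT k.+1 x = sinT k x + (-1) ^+ k * x ^+ k.*2.+1 / (k.*2.+1)`!%:R.
Proof. by rewrite /sinT big_ord_recr. Qed.

Lemma cosTN k x : cosT k (- x) = cosT k x.
Proof.
by apply: eq_bigr => j _; rewrite (exprNn x) -(signr_odd _ j.*2) odd_double expr0 mul1r.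
Qed.

Lemma sinTN k x : sinT k (- x) = - sinT k x.
Proof.
rewrite /sinT -sumrN; apply: eq_bigr => j _.
by rewrite (exprNn x) -(signr_odd _ j.*2.+1) oddS odd_double expr1 mulN1r mulrN mulNr.
Qed.

Lemma cosT0 k : cosT k.+1 0 = 1 :> R.
Proof.
rewrite /cosT big_ord_recl/= expr0 mulr1 fact0 divr1 big1 ?addr0// => j _.
by rewrite /bump/= add1n doubleS expr0n mulr0 mul0r.
Qed.

Lemma sinT0 k : sinT k 0 = 0 :> R.
Proof. by rewrite /sinT big1// => j _; rewrite expr0n mulr0 mul0r. Qed.

(** Up to sign, each remainder is the derivative of the next one in the chain cosine, sine, cosine,
    and so on, and all of those with at least one term removed vanish at 0. Starting from
    [cos y <= 1], monotonicity on the positive half-line propagates the sign. *)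
Let taylor_ge0 k x : 0 <= x ->
  0 <= (-1) ^+ k.+1 * (cos x - cosT k.+1 x) /\
  0 <= (-1) ^+ k.+1 * (sin x - sinT k.+1 x).
Proof.
have dcos m (y : R) : is_derive y 1 (fun z => (-1) ^+ m.+1 * (cos z - cosT m.+1 z))
    ((-1) ^+ m * (sin y - sinT m y)).
  have h : is_derive y 1 (cos - cosT m.+1) (- sin y - - sinT m y).
    by apply: is_deriveB; exact: is_derive_cosT.
  have -> : (-1) ^+ m * (sin y - sinT m y) = (-1) ^+ m.+1 * (- sin y - - sinT m y).
    by rewrite exprS; ring.
  exact: (@is_deriveZ _ _ _ _ ((-1) ^+ m.+1) _ _ _ h).
have dsin m (y : R) : is_derive y 1 (fun z => (-1) ^+ m * (sin z - sinT m z))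
    ((-1) ^+ m * (cos y - cosT m y)).
  have h : is_derive y 1 (sin - sinT m) (cos y - cosT m y).
    by apply: is_deriveB; exact: is_derive_sinT.
  exact: (@is_deriveZ _ _ _ _ ((-1) ^+ m) _ _ _ h).
have sin_of_cos m : (forall y, 0 <= y -> 0 <= (-1) ^+ m * (cos y - cosT m y)) ->
    forall y, 0 <= y -> 0 <= (-1) ^+ m * (sin y - sinT m y).
  move=> h y y0; have := derive_ge0_incr (dsin m) (fun z z0 => h z (ltW z0)) (lexx 0) y0.
  by rewrite sin0 sinT0 subrr mulr0.
elim: k x => [|k IH] x x0.
  have c1 y : 0 <= (-1) ^+ 1 * (cos y - cosT 1 y).
    rewrite expr1 mulN1r opprB subr_ge0 cosTS /cosT big_ord0 add0r !expr0 mul1r fact0 divr1.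
    exact: cos_le1.
  by split => //; exact: sin_of_cos.
have c2 y : 0 <= y -> 0 <= (-1) ^+ k.+2 * (cos y - cosT k.+2 y).
  move=> y0.
  have := derive_ge0_incr (dcos k.+1) (fun z z0 => (IH z (ltW z0)).2) (lexx 0) y0.
  by rewrite cos0 cosT0 subrr mulr0.
by split; [exact: c2|exact: sin_of_cos].
Qed.

Lemma cos_taylor_ge0 k x : 0 <= (-1) ^+ k.+1 * (cos x - cosT k.+1 x).
Proof.
have [x0|/ltW x0] := leP 0 x; first by have [] := taylor_ge0 k x0.
rewrite -(opprK x) cosN cosTN.
by have [] := taylor_ge0 k (_ : 0 <= - x); rewrite ?oppr_ge0.
Qed.

(** Two consecutive signed remainders add up to the Taylor term between them, so the positivity of
    one bounds the other from above. *)
Lemma cos_taylor_rec k x : (-1) ^+ k * (cos x - cosT k x) =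
  x ^+ k.*2 / (k.*2)`!%:R - (-1) ^+ k.+1 * (cos x - cosT k.+1 x).
Proof.
rewrite cosTS exprS.
have s : (-1) ^+ k * (-1) ^+ k = 1 :> R by rewrite -exprD addnn -signr_odd odd_double.
rewrite [RHS](_ : _ = (-1) ^+ k * (cos x - cosT k x) + (1 - (-1) ^+ k * (-1) ^+ k) *
  (x ^+ k.*2 / (k.*2)`!%:R)); last by ring.
by rewrite s subrr mul0r addr0.
Qed.

Lemma cos_taylor_le k x : (-1) ^+ k * (cos x - cosT k x) <= x ^+ k.*2 / (k.*2)`!%:R.
Proof. by rewrite cos_taylor_rec gerBl cos_taylor_ge0. Qed.

Lemma cos_taylor_bound k x : `|cos x - cosT k x| <= x ^+ k.*2 / (k.*2)`!%:R.
Proof.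
have -> : `|cos x - cosT k x| = `|(-1) ^+ k * (cos x - cosT k x)|.
  by rewrite normrM normrX normrN1 expr1n mul1r.
case: k => [|k].
  by rewrite /cosT big_ord0 subr0 !expr0 mul1r fact0 divr1 cos_max.
by rewrite ger0_norm ?cos_taylor_ge0// cos_taylor_le.
Qed.

Lemma cos_taylor_ge k x :
  x ^+ k.*2 / (k.*2)`!%:R - x ^+ k.+1.*2 / (k.+1.*2)`!%:R <=
  (-1) ^+ k * (cos x - cosT k x).
Proof. by rewrite cos_taylor_rec lerB// cos_taylor_le. Qed.

Lemma sin_taylor_bound k x : `|sin x - sinT k x| <= `|x| ^+ k.*2.+1 / (k.*2.+1)`!%:R.
Proof.
wlog x0 : x / 0 <= x.
  move=> h; have [/h//|/ltW x0] := leP 0 x.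
  have := h (- x); rewrite oppr_ge0 => /(_ x0).
  by rewrite sinN sinTN -opprD normrN normrN.
have sgn : (-1) ^+ k * (-1) ^+ k = 1 :> R by rewrite -exprD addnn -signr_odd odd_double.
have -> : `|sin x - sinT k x| = `|(-1) ^+ k * (sin x - sinT k x)|.
  by rewrite normrM normrX normrN1 expr1n mul1r.
rewrite (ger0_norm x0).
have le : (-1) ^+ k * (sin x - sinT k x) <= x ^+ k.*2.+1 / (k.*2.+1)`!%:R.
  have := (taylor_ge0 k x0).2; rewrite sinTS exprS.
  rewrite (_ : -1 * _ * _ = (-1) ^+ k * (-1) ^+ k * (x ^+ k.*2.+1 / (k.*2.+1)`!%:R) -
    (-1) ^+ k * (sin x - sinT k x)); last by ring.
  by rewrite sgn mul1r subr_ge0.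
case: k le sgn => [_ _|k le _].
  rewrite /sinT big_ord0 subr0 !expr0 mul1r expr1 divr1.
  (* With no term removed the remainder is [sin x] itself, which changes sign. Up to 1 it is
     nonnegative and at most [x]; beyond 1 the bound [|sin x| <= 1] is enough. *)
  have [x1|x1] := leP x 1; last by rewrite (le_trans (sin_max x))// ltW.
  rewrite ger0_norm; last by apply: sin_ge0_pi; rewrite x0 (le_trans x1)// (le_trans _ (pi_ge2 R))// ler1n.
  have := (taylor_ge0 0 x0).2; rewrite sinTS /sinT big_ord0 add0r !expr0 expr1 mul1r divr1.
  by rewrite expr1 mulN1r opprB subr_ge0.
by rewrite ger0_norm ?(taylor_ge0 k x0).2.
Qed.

End TrigTaylor.
(** Stands in for the positivity of the integral of [dF] over the half-line: [F 1] is positive by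
    the mean value theorem, and [F] does not decrease afterwards. *)
Lemma cvgy_derive_gt0 {R : realType} (F dF : R -> R) (l : R) :
  (forall x : R, is_derive x 1 F (dF x)) -> (forall x, 0 < x -> 0 < dF x) ->
  F 0 = 0 -> F x @[x --> +oo] --> l -> 0 < l.
Proof.
move=> dF_ dF0 F0 Fl.
have cF := is_derive_continuous dF_.
have F1 : 0 < F 1.
  have [c c01 F1] := MVT ltr01 (fun x _ => dF_ x) (continuous_subspaceT cF).
  move: c01; rewrite in_itv/= => /andP[c0 _].
  by move: F1; rewrite F0 !subr0 mulr1 => ->; exact: dF0.
apply: lt_le_trans F1 _.
apply: (cvgr_to_ge Fl); near=> x.
by apply: (derive_ge0_incr dF_) => // y /dF0/ltW.
Unshelve. all: by end_near. Qed.

(** * Divided differences at the nodes [mu k ^+ 2] and the weighted power sums they give *)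

Section DividedDifferences.
Context {R : realType} {n : nat} (mu : 'I_n -> R).
Hypotheses (mu_inj : injective mu) (mu_gt0 : forall k, 0 < mu k).
Implicit Types (A : {set 'I_n}) (i k : 'I_n).

(* [\sum_(k in A) theta_on A k * f (mu k ^+ 2)] is the divided difference of
   [s ^+ #|A|.-1 * f s] at the nodes [mu k ^+ 2], [k \in A]. *)
Definition theta_on A k : R :=
  \prod_(j in A :\ k) (mu k ^+ 2 / (mu k ^+ 2 - mu j ^+ 2)).

Lemma musqB_neq0 k i : k != i -> mu k ^+ 2 - mu i ^+ 2 != 0.
Proof.
move=> ki; rewrite subr_sqr mulf_neq0//.
  by rewrite subr_eq0; apply: contra_neq ki => /mu_inj.
by rewrite gt_eqF// addr_gt0.
Qed.

(** The factor [mu k ^+ 2 - mu i ^+ 2] kills the term [k = i]; in the others it cancels the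
    denominator that node [i] contributes to [theta_on A k], leaving [mu k ^+ 2]. The recursions
    below are instances for particular [f]. *)
Lemma theta_on_rec (f : 'I_n -> R) A i : i \in A ->
  \sum_(k in A) theta_on A k * ((mu k ^+ 2 - mu i ^+ 2) * f k) =
  \sum_(k in A :\ i) theta_on (A :\ i) k * (mu k ^+ 2 * f k).
Proof.
move=> iA; rewrite (big_setD1 i)//= subrr mul0r mulr0 add0r.
apply: eq_bigr => k; rewrite !inE => /andP[ki kA].
rewrite /theta_on (big_setD1 i) ?inE ?iA 1?eq_sym ?ki//=.
rewrite (_ : (A :\ k) :\ i = (A :\ i) :\ k); last by apply/setP => j; rewrite !inE andbCA.
have := musqB_neq0 ki => h.
by field.
Qed.

(** With [f = 1] the recursion expresses the second sum through the first, once for every removed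
    node. Comparing the expressions for two distinct nodes [i], [i'] gives
    [(mu i ^ 2 - mu i' ^ 2) * (S - 1) = 0], where [S] is the sum of the weights. *)
Lemma theta_on_sums A : A != finset.set0 ->
  \sum_(k in A) theta_on A k = 1 /\
  \sum_(k in A) theta_on A k * mu k ^+ 2 = \sum_(k in A) mu k ^+ 2.
Proof.
elim: {A}#|A| {-2}A (erefl #|A|) => [|m IH] A cA A0.
  by rewrite (cards0_eq cA) eqxx in A0.
have [i iA] := finset.set0Pn _ A0.
have cAi i' : i' \in A -> #|A :\ i'| = m.
  by move=> iA'; apply/eqP; rewrite -eqSS -cA (cardsD1 i' A) iA'.
have rec1 i' : i' \in A ->
    \sum_(k in A) theta_on A k * (mu k ^+ 2 - mu i' ^+ 2) =
    \sum_(k in A :\ i') mu k ^+ 2.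
  move=> iA'; have := theta_on_rec (fun _ => 1) iA'.
  under eq_bigr do rewrite mulr1.
  under [in RHS]eq_bigr do rewrite mulr1.
  move=> ->; have [->|Ai0] := eqVneq (A :\ i') finset.set0; first by rewrite !big_set0.
  by have [] := IH _ (cAi _ iA') Ai0.
have rec2 i' : i' \in A ->
    \sum_(k in A) theta_on A k * mu k ^+ 2 =
    \sum_(k in A :\ i') mu k ^+ 2 + mu i' ^+ 2 * \sum_(k in A) theta_on A k.
  move=> iA'; rewrite -rec1// mulr_sumr -big_split/=.
  by apply: eq_bigr => k _; ring.
have S1 : \sum_(k in A) theta_on A k = 1.
  have [Ai0|/finset.set0Pn[i' ]] := eqVneq (A :\ i) finset.set0.
    rewrite (big_setD1 i)//= Ai0 big_set0 addr0 /theta_on Ai0 big_set0//.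
  rewrite !inE => /andP[ii' iA'].
  have := rec2 _ iA; rewrite (rec2 _ iA') => /eqP.
  have e j : j \in A -> \sum_(k in A :\ j) mu k ^+ 2 = \sum_(k in A) mu k ^+ 2 - mu j ^+ 2.
    by move=> jA; rewrite [in RHS](big_setD1 j)//= [RHS]addrC addKr.
  rewrite !e// => /eqP h.
  apply: (mulfI (musqB_neq0 ii')); rewrite mulr1 mulrBl; lra.
by split=> //; rewrite (rec2 _ iA) S1 mulr1 [RHS](big_setD1 i)//= addrC.
Qed.

(** Induction on the number of nodes. With [f k = 1 / (1 + mu k ^ 2 * z)] one has [z * (mu k ^ 2 -
    mu i ^ 2) * f k = 1 - (1 + mu i ^ 2 * z) * f k] and [z * mu k ^ 2 * f k = 1 - f k]. In the
    recursion multiplied by [z], the constants sum to 1 on both sides and cancel. *)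
Lemma theta_on_partial_fractions A (z : R) : A != finset.set0 -> 0 <= z ->
  \sum_(k in A) theta_on A k / (1 + mu k ^+ 2 * z) =
  \prod_(k in A) (1 + mu k ^+ 2 * z)^-1.
Proof.
move=> + z0; elim: {A}#|A| {-2}A (erefl #|A|) => [|m IH] A cA A0.
  by rewrite (cards0_eq cA) eqxx in A0.
have D k : 1 + mu k ^+ 2 * z != 0.
  by rewrite gt_eqF// ltr_pwDl// mulr_ge0// sqr_ge0.
have [i iA] := finset.set0Pn _ A0.
have cAi : #|A :\ i| = m by apply/eqP; rewrite -eqSS -cA (cardsD1 i A) iA.
have [Ai0|Ai0] := eqVneq (A :\ i) finset.set0.
  rewrite [in LHS](big_setD1 i)//= [in RHS](big_setD1 i)//=.
  by rewrite Ai0 !big_set0 addr0 mulr1 /theta_on Ai0 big_set0 mul1r.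
rewrite [RHS](big_setD1 i)//= -(IH _ cAi Ai0).
apply: (mulfI (D i)); rewrite mulVKf//.
have := theta_on_rec (fun k => (1 + mu k ^+ 2 * z)^-1) iA.
move/(congr1 ( *%R z)); rewrite !mulr_sumr.
rewrite (_ : \sum_(k in A :\ i) _ = \sum_(k in A :\ i) (theta_on (A :\ i) k
    - theta_on (A :\ i) k / (1 + mu k ^+ 2 * z))); last first.
  by apply: eq_bigr => k _; field; rewrite D.
rewrite (_ : \sum_(k in A) _ = \sum_(k in A) (theta_on A k
    - (1 + mu i ^+ 2 * z) * (theta_on A k / (1 + mu k ^+ 2 * z)))); last first.
  by apply: eq_bigr => k _; field; rewrite D.
rewrite !big_split/= (theta_on_sums A0).1 (theta_on_sums Ai0).1 => /addrI.
by rewrite !sumrN => /oppr_inj.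
Qed.

Lemma is_derive_atan_scale (a x : R) : a != 0 ->
  is_derive x 1 (fun v => atan (a * v) / a) (1 + a ^+ 2 * x ^+ 2)^-1.
Proof.
move=> a0; have D : 1 + (a * x) ^+ 2 != 0.
  by rewrite gt_eqF// ltr_pwDl// sqr_ge0.
have h : is_derive x (1 : R) (fun v => a * v) a.
  by apply: trigger_derive; rewrite /GRing.scale/= mulr1.
have := is_derive1_comp (is_derive1_atan (a * x)) h => {}h.
have -> : (fun v => atan (a * v) / a) = a^-1 *: (atan \o (fun v => a * v)).
  by apply/funext => v; rewrite /GRing.scale/= mulrC.
apply: trigger_derive; rewrite /GRing.scale/=; field.
by rewrite a0 D.
Qed.

Lemma cvgy_atan_scale (a : R) : 0 < a ->
  atan (a * v) / a @[v --> +oo] --> pi / 2 / a.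
Proof.
move=> a0; apply: cvgM; last exact: cvg_cst.
have h : a * v @[v --> +oo] --> +oo by apply: gt0_cvgMry => //; exact: cvg_id.
exact: (cvg_comp _ _ h (@cvgy_atan R)).
Qed.

(* By partial fractions the derivative of [G A] is the positive product of the
   [(1 + mu k ^+ 2 * v ^+ 2)^-1], and [G A] tends to [pi / 2] times the sum to be
   bounded. *)
Let G A v : R := \sum_(k in A) theta_on A k * (atan (mu k * v) / mu k).

Let is_derive_G A (x : R) : A != finset.set0 ->
  is_derive x 1 (G A) (\prod_(k in A) (1 + mu k ^+ 2 * x ^+ 2)^-1).
Proof.
move=> A0; rewrite -theta_on_partial_fractions ?sqr_ge0//.
apply: is_derive_bigsum => k _.
have := is_derive_atan_scale x (lt0r_neq0 (mu_gt0 k)) => h.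
exact: (@is_deriveZ _ _ _ _ (theta_on A k) _ _ _ h).
Qed.

Let G0 A : G A 0 = 0.
Proof. by rewrite /G big1// => k _; rewrite mulr0 atan0 mul0r mulr0. Qed.

Let cvgy_G A : G A v @[v --> +oo] --> pi / 2 * \sum_(k in A) theta_on A k / mu k.
Proof.
rewrite mulr_sumr; apply: cvg_big => [|k _]; first exact: add_continuous.
rewrite mulrCA.
by apply: cvgM; [exact: cvg_cst|exact: cvgy_atan_scale].
Qed.

Let prod_lt_pos A (x : R) : 0 < \prod_(k in A) (1 + mu k ^+ 2 * x ^+ 2)^-1.
Proof.
by apply: prodr_gt0 => k _; rewrite invr_gt0 ltr_pwDl// mulr_ge0// sqr_ge0.
Qed.

Lemma sum_theta_on_inv A : A != finset.set0 ->
  0 < \sum_(k in A) theta_on A k / mu k.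
Proof.
move=> A0; have := cvgy_derive_gt0 (fun x => is_derive_G x A0)
  (fun x _ => prod_lt_pos A x) (G0 A) (@cvgy_G A).
by rewrite pmulr_rgt0// divr_gt0// pi_gt0.
Qed.

(** Up to the factor [pi / 2], the difference of the two sides is the limit of a function whose
    derivative is the [i]-th factor minus the whole product. This is positive because the remaining
    factors, of which there is at least one, are below 1. *)
Lemma sum_theta_on_inv_lt A i : i \in A -> A :\ i != finset.set0 ->
  \sum_(k in A) theta_on A k / mu k < (mu i)^-1.
Proof.
move=> iA Ai0.
have A0 : A != finset.set0 by apply/finset.set0Pn; exists i.
have pi2 : 0 < pi / 2 :> R by rewrite divr_gt0// pi_gt0.
rewrite -subr_gt0 -(pmulr_rgt0 _ pi2) mulrBr.
pose F v := atan (mu i * v) / mu i - G A v.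
apply: (@cvgy_derive_gt0 _ F (fun x => (1 + mu i ^+ 2 * x ^+ 2)^-1 -
    \prod_(k in A) (1 + mu k ^+ 2 * x ^+ 2)^-1)).
- move=> x; apply: is_deriveB; last exact: is_derive_G.
  exact/is_derive_atan_scale/lt0r_neq0.
- move=> x x0; rewrite (big_setD1 i)//= subr_gt0.
  have inv_gt0 k : 0 < (1 + mu k ^+ 2 * x ^+ 2)^-1.
    by rewrite invr_gt0 ltr_pwDl// mulr_ge0// sqr_ge0.
  rewrite gtr_pMr//; have [j jA] := finset.set0Pn _ Ai0.
  rewrite (big_setD1 j)//=.
  have inv_lt1 k : (1 + mu k ^+ 2 * x ^+ 2)^-1 < 1.
    by rewrite invf_lt1 ?ltrDl ?mulr_gt0 ?exprn_gt0// -invr_gt0.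
  apply: le_lt_trans (inv_lt1 j); rewrite ler_piMr//; first exact: ltW.
  by apply: prodr_ile1 => k _; rewrite !ltW.
- by rewrite /F G0 mulr0 atan0 mul0r subr0.
- by apply: cvgB; [exact: cvgy_atan_scale|exact: cvgy_G].
Qed.

Lemma theta_on_moment_rec A i m : i \in A ->
  \sum_(k in A) theta_on A k * mu k ^+ m.+2 =
  \sum_(k in A :\ i) theta_on (A :\ i) k * mu k ^+ m.+2 +
  mu i ^+ 2 * \sum_(k in A) theta_on A k * mu k ^+ m.
Proof.
move=> iA; have := theta_on_rec (fun k => mu k ^+ m) iA.
under [in RHS]eq_bigr do rewrite -exprD add2n.
move=> <-; rewrite mulr_sumr -big_split/=.
by apply: eq_bigr => k _; rewrite -add2n exprD; ring.
Qed.

(** The moment recursion at order 1, where the lower moment has order -1. This is where the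
    arctangent estimates enter the odd orders. *)
Lemma theta_on_moment1_rec A i : i \in A ->
  \sum_(k in A) theta_on A k * mu k =
  \sum_(k in A :\ i) theta_on (A :\ i) k * mu k +
  mu i ^+ 2 * \sum_(k in A) theta_on A k / mu k.
Proof.
move=> iA; have := theta_on_rec (fun k => (mu k)^-1) iA.
rewrite (_ : \sum_(k in A :\ i) _ = \sum_(k in A :\ i) theta_on (A :\ i) k * mu k).
  move=> <-; rewrite mulr_sumr -big_split/=.
  by apply: eq_bigr => k _; field; rewrite gt_eqF.
by apply: eq_bigr => k _; field; rewrite gt_eqF.
Qed.

(** The recursion lowers either the order by two or the number of nodes by one, with positive
    coefficients. It ends at order 0, where the sum is 1, and at order -1, settled by
    [sum_theta_on_inv]. *)
Lemma theta_on_moment_gt0 A m : A != finset.set0 ->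
  0 < \sum_(k in A) theta_on A k * mu k ^+ m.
Proof.
elim/ltn_ind: m A => -[_ A A0|[_|m IHm]].
- by under eq_bigr do rewrite expr0 mulr1; rewrite (theta_on_sums A0).1.
- move=> A; under eq_bigr do rewrite expr1.
  elim: {A}#|A| {-2}A (erefl #|A|) => [|N IH] A cA A0.
    by rewrite (cards0_eq cA) eqxx in A0.
  have [i iA] := finset.set0Pn _ A0.
  rewrite (theta_on_moment1_rec iA) ltr_wpDl//; last first.
    by rewrite mulr_gt0 ?exprn_gt0// sum_theta_on_inv.
  have [->|Ai0] := eqVneq (A :\ i) finset.set0; first by rewrite big_set0.
  by rewrite ltW// IH//; apply/eqP; rewrite -eqSS -cA (cardsD1 i A) iA.
move=> A.
elim: {A}#|A| {-2}A (erefl #|A|) => [|N IH] A cA A0.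
  by rewrite (cards0_eq cA) eqxx in A0.
have [i iA] := finset.set0Pn _ A0.
rewrite (theta_on_moment_rec _ iA) ltr_wpDl//; last first.
  by rewrite mulr_gt0 ?exprn_gt0// IHm.
have [->|Ai0] := eqVneq (A :\ i) finset.set0; first by rewrite big_set0.
by rewrite ltW// IH//; apply/eqP; rewrite -eqSS -cA (cardsD1 i A) iA.
Qed.

Lemma theta_on_moment_lt A i m : i \in A -> A :\ i != finset.set0 ->
  \sum_(k in A :\ i) theta_on (A :\ i) k * mu k ^+ m.+1 <
  \sum_(k in A) theta_on A k * mu k ^+ m.+1.
Proof.
move=> iA Ai0.
have A0 : A != finset.set0 by apply/finset.set0Pn; exists i.
case: m => [|m].
  under [ltLHS]eq_bigr do rewrite expr1.
  under [ltRHS]eq_bigr do rewrite expr1.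
  rewrite (theta_on_moment1_rec iA) ltrDl mulr_gt0 ?exprn_gt0//.
  exact: sum_theta_on_inv.
by rewrite (theta_on_moment_rec _ iA) ltrDl mulr_gt0 ?exprn_gt0// theta_on_moment_gt0.
Qed.

(** Removing the other nodes one at a time strictly lowers the moment, down to the single node [i],
    whose weight is 1. *)
Lemma theta_on_moment_gt1 A i m : i \in A -> A :\ i != finset.set0 ->
  mu i ^+ m.+1 < \sum_(k in A) theta_on A k * mu k ^+ m.+1.
Proof.
elim: {A}#|A| {-2}A (erefl #|A|) => [|N IH] A cA iA Ai0.
  by rewrite (cards0_eq cA) inE in iA.
have [j] := finset.set0Pn _ Ai0; rewrite !inE => /andP[ji jA].
have Aj0 : A :\ j != finset.set0.
  by apply/finset.set0Pn; exists i; rewrite !inE eq_sym ji.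
have iAj : i \in A :\ j by rewrite !inE eq_sym ji.
have [Aji|Aji] := eqVneq ((A :\ j) :\ i) finset.set0; last first.
  apply: lt_trans (theta_on_moment_lt _ jA Aj0).
  by apply: IH => //; apply/eqP; rewrite -eqSS -cA (cardsD1 j A) jA.
apply: le_lt_trans (theta_on_moment_lt _ jA Aj0).
by rewrite (big_setD1 i)//= Aji big_set0 addr0 /theta_on Aji big_set0 mul1r.
Qed.

(** Removing node [i] lowers the moment by [mu i ^ 2] times the moment two orders below, which
    exceeds [mu i ^ (m + 1)]. So each removal costs more than [mu i ^ (m + 3)], and equality holds
    for a single node. *)
Lemma theta_on_moment_gt_sum A m : (1 < #|A|)%N ->
  \sum_(k in A) mu k ^+ m.+3 < \sum_(k in A) theta_on A k * mu k ^+ m.+3.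
Proof.
move E : #|A| => N; elim: N A E => [//|N IH] A cA; rewrite ltnS => N0.
have /finset.set0Pn[i iA] : A != finset.set0 by rewrite -card_gt0 cA.
have cAi : #|A :\ i| = N by apply/eqP; rewrite -eqSS -cA (cardsD1 i A) iA.
have Ai0 : A :\ i != finset.set0 by rewrite -card_gt0 cAi.
rewrite (theta_on_moment_rec _ iA) (big_setD1 i)//= addrC ler_ltD//.
  move: N0; rewrite leq_eqVlt => /predU1P[N1|N1]; last by rewrite ltW// IH.
  have /cards1P[j ->] : #|A :\ i| == 1%N by rewrite cAi N1.
  by rewrite !big_set1 /theta_on finset.setDv big_set0 mul1r.
rewrite -add2n exprD ltr_pM2l ?exprn_gt0//.
exact: theta_on_moment_gt1.
Qed.

(** The same descent at order 1, with the opposite inequality: the moment of order -1 is below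
    [1 / mu i], so removing node [i] costs less than [mu i]. *)
Lemma theta_on_moment1_lt_sum A : (1 < #|A|)%N ->
  \sum_(k in A) theta_on A k * mu k < \sum_(k in A) mu k.
Proof.
move E : #|A| => N; elim: N A E => [//|N IH] A cA; rewrite ltnS => N0.
have /finset.set0Pn[i iA] : A != finset.set0 by rewrite -card_gt0 cA.
have cAi : #|A :\ i| = N by apply/eqP; rewrite -eqSS -cA (cardsD1 i A) iA.
have Ai0 : A :\ i != finset.set0 by rewrite -card_gt0 cAi.
rewrite (theta_on_moment1_rec iA) [ltRHS](big_setD1 i)//= [ltRHS]addrC ler_ltD//.
  move: N0; rewrite leq_eqVlt => /predU1P[N1|N1]; last by rewrite ltW// IH.
  have /cards1P[j ->] : #|A :\ i| == 1%N by rewrite cAi N1.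
  by rewrite !big_set1 /theta_on finset.setDv big_set0 mul1r.
rewrite expr2 -mulrA gtr_pMr// mulrC -ltr_pdivlMr// div1r.
exact: sum_theta_on_inv_lt.
Qed.

End DividedDifferences.

(** * Complex-valued remainders of order [t ^ m] on bounded intervals of the positive half-line *)

Section BigO.
Context {R : realType}.
Implicit Types (f g h : R -> R[i]) (m : nat).

(* A bound on every [0, B], rather than near 0, makes the class stable under dilations
   without any change of neighbourhood. *)
Definition bigO0 m f := forall B : R, exists C : R,
  forall t, 0 <= t <= B -> `|f t| <= (C * t ^+ m)%:C%C.

Lemma bigO0_eq m f g : f =1 g -> bigO0 m f -> bigO0 m g.
Proof. by move=> fg fO B; have [C h] := fO B; exists C => t; rewrite -fg; exact: h. Qed.

Lemma bigO0D m f g : bigO0 m f -> bigO0 m g -> bigO0 m (fun t => f t + g t).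
Proof.
move=> fO gO B; have [C hC] := fO B; have [D hD] := gO B.
exists (C + D) => t tB; rewrite (le_trans (ler_normD _ _))//.
by rewrite mulrDl rmorphD/= lerD ?hC ?hD.
Qed.

Lemma bigO0M m p f g : bigO0 m f -> bigO0 p g -> bigO0 (m + p) (fun t => f t * g t).
Proof.
move=> fO gO B; have [C hC] := fO B; have [D hD] := gO B.
exists (C * D) => t tB; rewrite normrM exprD mulrACA rmorphM/=.
by rewrite ler_pM ?hC ?hD.
Qed.

Lemma bigO0_cst (c : R[i]) : bigO0 0 (fun=> c).
Proof.
move=> B; exists (complex.Re `|c|) => t _; rewrite expr0 mulr1.
by rewrite normc_def.
Qed.

Lemma bigO0Z m (c : R[i]) f : bigO0 m f -> bigO0 m (fun t => c * f t).
Proof. by move=> fO; exact: (bigO0M (bigO0_cst c) fO). Qed.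

Lemma bigO0N m f : bigO0 m f -> bigO0 m (fun t => - f t).
Proof. by move=> /(bigO0Z (-1)); apply: bigO0_eq => t; rewrite mulN1r. Qed.

Lemma bigO0B m f g : bigO0 m f -> bigO0 m g -> bigO0 m (fun t => f t - g t).
Proof. by move=> fO /bigO0N; exact: bigO0D. Qed.

Lemma bigO00 m : bigO0 m (fun=> 0).
Proof. by move=> B; exists 0 => t _; rewrite normr0 mul0r. Qed.

Lemma bigO0_sum m (I : Type) (r : seq I) (P : pred I) (F : I -> R -> R[i]) :
  (forall i, P i -> bigO0 m (F i)) -> bigO0 m (fun t => \sum_(i <- r | P i) F i t).
Proof.
move=> FO; elim: r => [|i r IH].
  by apply: bigO0_eq (bigO00 m) => t; rewrite big_nil.
case: (boolP (P i)) => Pi.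
  by apply: bigO0_eq (bigO0D (FO _ Pi) IH) => t; rewrite big_cons Pi.
by apply: bigO0_eq IH => t; rewrite big_cons (negbTE Pi).
Qed.

Lemma bigO0_monom m : bigO0 m (fun t => t%:C%C ^+ m).
Proof.
move=> B; exists 1 => t /andP[t0 _].
by rewrite mul1r -rmorphXn/= normc_def/= expr0n/= addr0 sqrtr_sqr ger0_norm// exprn_ge0.
Qed.

Lemma bigO0_le m p f : (m <= p)%N -> bigO0 p f -> bigO0 m f.
Proof.
move=> /subnKC <- fO B; have [C hC] := fO B.
exists (`|C| * `|B| ^+ (p - m)) => t /andP[t0 tB].
apply: (le_trans (hC t _)); first by rewrite t0.
rewrite lecR -mulrA exprD [X in _ <= _ * X]mulrC.
rewrite (le_trans (ler_wpM2r _ (ler_norm C)))//.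
  by rewrite mulr_ge0 ?exprn_ge0.
rewrite ler_wpM2l// ler_wpM2l ?exprn_ge0//.
by rewrite lerXn2r ?nnegrE// (le_trans tB)// ler_norm.
Qed.

Lemma bigO0_scale m (a : R) f : 0 <= a -> bigO0 m f -> bigO0 m (fun t => f (a * t)).
Proof.
move=> a0 fO B; have [C hC] := fO (a * B).
exists (C * a ^+ m) => t /andP[t0 tB].
by rewrite -mulrA -exprMn; apply: hC; rewrite mulr_ge0// ler_wpM2l.
Qed.

Lemma bigO0_monom_eq0 m (c : R[i]) :
  bigO0 m.+1 (fun t => c * t%:C%C ^+ m) -> c = 0.
Proof.
move=> /(_ 1)[C hC].
set c' := Num.sqrt (complex.Re c ^+ 2 + complex.Im c ^+ 2).
have c0 : 0 <= c' by exact: sqrtr_ge0.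
have h t : 0 < t <= 1 -> c' <= C * t.
  move=> /andP[t0 t1]; have := hC t; rewrite ltW// => /(_ t1).
  rewrite normrM -rmorphXn/= [`|_%:C%C|]normc_def/= expr0n/= addr0 sqrtr_sqr.
  rewrite (ger0_norm (exprn_ge0 m (ltW t0))) exprS mulrA normc_def -rmorphM/= lecR.
  by rewrite ler_pM2r ?exprn_gt0.
apply/eqP; rewrite -normr_eq0 normc_def -/c'; apply/eqP; congr (_%:C)%C.
apply/eqP; rewrite eq_le c0 andbT leNgt; apply/negP => c'0.
have C0 : 0 < C by have := lt_le_trans c'0 (h 1 _); rewrite ltr01 lexx mulr1; exact.
(* At this point the bound [C * t] is at most half of [c']. *)
have := h (Num.min 1 (c' / (2 * C))).
rewrite lt_min ltr01 divr_gt0 ?mulr_gt0//= ge_min lexx => /(_ isT).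
apply/negP; rewrite -ltNge.
apply: (@le_lt_trans _ _ (C * (c' / (2 * C)))).
  by rewrite ler_pM2l// ge_min lexx orbT.
have -> : C * (c' / (2 * C)) = c' / 2 by field; rewrite gt_eqF.
lra.
Qed.

End BigO.

(** * The functional equation determines the Taylor coefficients from those of order 0 and 2 *)

Section Uniqueness.
Context {R : realType} {n : nat} (mu : 'I_n -> R).
Hypotheses (n_ge2 : (2 <= n)%N) (mu_inj : injective mu) (mu_gt0 : forall k, 0 < mu k).

Lemma theta_onT k : theta_on mu [set: 'I_n]%SET k = theta mu k.
Proof. by rewrite /theta_on /theta; apply: eq_bigl => j; rewrite !inE andbT. Qed.

Lemma sum_theta_moment_neq m : (0 < m)%N -> m != 2 ->
  \sum_(k < n) theta mu k * mu k ^+ m != \sum_(k < n) mu k ^+ m.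
Proof.
have cT : (1 < #|[set: 'I_n]%SET|)%N by rewrite cardsT card_ord.
have E (F : 'I_n -> R) : \sum_(k < n) F k = \sum_(k in [set: 'I_n]%SET) F k.
  by apply: eq_bigl => k; rewrite inE.
move=> m0 m2; rewrite !E; under eq_bigr do rewrite -theta_onT.
case: m m0 m2 => [|[|[|m]]]// _ _.
  under eq_bigr do rewrite expr1; under [X in _ != X]eq_bigr do rewrite expr1.
  by rewrite lt_eqF// theta_on_moment1_lt_sum.
by rewrite gt_eqF// theta_on_moment_gt_sum.
Qed.

(** Since every factor is [1 + O(t)], perturbations of order [t ^ m] in the factors simply add up.
    The induction splits the difference of products as [(f k - g k) * prod f + g k * (prod f - prod
    g)], and replacing [prod f] or [g k] by 1 next to [t ^ m] costs one more order. *)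
Lemma bigO0_prodB m (s : seq 'I_n) (f g : 'I_n -> R -> R[i]) (d : 'I_n -> R[i]) :
  (forall k, bigO0 m.+1 (fun t => f k t - g k t - d k * t%:C%C ^+ m)) ->
  (forall k, bigO0 1 (fun t => f k t - 1)) ->
  (forall k, bigO0 1 (fun t => g k t - 1)) ->
  bigO0 m.+1 (fun t => \prod_(k <- s) f k t - \prod_(k <- s) g k t -
                       (\sum_(k <- s) d k) * t%:C%C ^+ m).
Proof.
move=> fg f1 g1.
have bd (h : R -> R[i]) : bigO0 1 (fun t => h t - 1) -> bigO0 0 h.
  move=> h1; apply: bigO0_eq (bigO0D (bigO0_le (leq0n 1) h1) (bigO0_cst 1)) => t.
  by rewrite subrK.
have P1 (r : seq 'I_n) : bigO0 1 (fun t => \prod_(k <- r) f k t - 1).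
  elim: r => [|k r IH].
    by apply: bigO0_eq (bigO00 1) => t; rewrite big_nil subrr.
  apply: bigO0_eq (bigO0D (bigO0M (bd _ (f1 k)) IH) (f1 k)) => t.
  by rewrite big_cons; ring.
elim: s => [|k s IH].
  by apply: bigO0_eq (bigO00 _) => t; rewrite !big_nil; ring.
have h1 := bigO0M (fg k) (bd _ (P1 s)).
have h2 := bigO0M (bigO0Z (d k) (bigO0_monom m)) (P1 s).
have h3 := bigO0M (bd _ (g1 k)) IH.
have h4 := bigO0M (g1 k) (bigO0Z (\sum_(k <- s) d k) (bigO0_monom m)).
rewrite addn0 in h1; rewrite addn1 in h2; rewrite add1n in h4.
apply: bigO0_eq (bigO0D (bigO0D h1 h2) (bigO0D h3 h4)) => t.
by rewrite !big_cons; ring.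
Qed.

(** Strong induction on the order: if the coefficients agree below [m], then [f - g] is [c * t ^ m]
    up to higher order. Both sides of the equation then have explicit leading differences, whose
    comparison forces [c = 0] unless [m] is 0 or 2. *)
Lemma functional_eq_unique (f g : R -> R[i]) (a b : nat -> R[i]) :
  (forall t, \prod_(k < n) f (mu k * t) = \sum_(k < n) (theta mu k)%:C%C * f (mu k * t)) ->
  (forall t, \prod_(k < n) g (mu k * t) = \sum_(k < n) (theta mu k)%:C%C * g (mu k * t)) ->
  (forall N, bigO0 N (fun t => f t - \sum_(j < N) a j * t%:C%C ^+ j)) ->
  (forall N, bigO0 N (fun t => g t - \sum_(j < N) b j * t%:C%C ^+ j)) ->
  a 0 = 1 -> b 0 = 1 -> a 2 = b 2 -> a =1 b.
Proof.
move=> fE gE fa gb a0 b0 a2 m.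
elim/ltn_ind: m => m IH.
case: m IH => [|m] IH; first by rewrite a0 b0.
have [->//|m2] := eqVneq m.+1 2.
set c := a m.+1 - b m.+1.
have fg : bigO0 m.+2 (fun t => f t - g t - c * t%:C%C ^+ m.+1).
  apply: bigO0_eq (bigO0B (fa m.+2) (gb m.+2)) => t.
  rewrite !(big_ord_recr m.+1)/= /c.
  rewrite (eq_bigr (fun j : 'I_m.+1 => b j * t%:C%C ^+ j)); last first.
    by move=> j _; rewrite IH.
  by rewrite /=; ring.
have one (h : R -> R[i]) (e : nat -> R[i]) : e 0 = 1 ->
    (forall N, bigO0 N (fun t => h t - \sum_(j < N) e j * t%:C%C ^+ j)) ->
    forall k, bigO0 1 (fun t => h (mu k * t) - 1).
  move=> e0 he k; have := bigO0_scale (ltW (mu_gt0 k)) (he 1).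
  by apply: bigO0_eq => t; rewrite big_ord1 expr0 mulr1 e0.
have fgk k : bigO0 m.+2 (fun t => f (mu k * t) - g (mu k * t) -
    (c * (mu k)%:C%C ^+ m.+1) * t%:C%C ^+ m.+1).
  apply: bigO0_eq (bigO0_scale (ltW (mu_gt0 k)) fg) => t.
  by rewrite rmorphM/= exprMn mulrA.
have h1 := bigO0_prodB (index_enum 'I_n) fgk (one _ _ a0 fa) (one _ _ b0 gb).
have h2 : bigO0 m.+2 (fun t => \sum_(k < n) (theta mu k)%:C%C *
    (f (mu k * t) - g (mu k * t) - (c * (mu k)%:C%C ^+ m.+1) * t%:C%C ^+ m.+1)).
  by apply: bigO0_sum => k _; exact: bigO0Z.
(* Product side minus sum side: the functional equations of [f] and [g] cancel everything but this
   monomial. *)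
have h3 : bigO0 m.+2 (fun t => c * (\sum_(k < n) theta mu k * mu k ^+ m.+1 -
    \sum_(k < n) mu k ^+ m.+1)%:C%C * t%:C%C ^+ m.+1).
  apply: bigO0_eq (bigO0B h1 h2) => t.
  have -> : \sum_(k < n) (theta mu k)%:C%C *
      (f (mu k * t) - g (mu k * t) - (c * (mu k)%:C%C ^+ m.+1) * t%:C%C ^+ m.+1) =
      \sum_(k < n) (theta mu k)%:C%C * f (mu k * t) -
      \sum_(k < n) (theta mu k)%:C%C * g (mu k * t) -
      c * t%:C%C ^+ m.+1 * \sum_(k < n) (theta mu k * mu k ^+ m.+1)%:C%C.
    rewrite mulr_sumr -!sumrB; apply: eq_bigr => k _.
    by rewrite rmorphM rmorphXn/=; ring.
  rewrite fE gE rmorphB/= !rmorph_sum/= -mulr_sumr.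
  by under [\sum_(k < n) (mu k ^+ m.+1)%:C%C]eq_bigr do rewrite rmorphXn/=; ring.
have := bigO0_monom_eq0 h3 => /eqP; rewrite mulf_eq0 => /orP[|].
  by rewrite subr_eq0 => /eqP.
rewrite fmorph_eq0 subr_eq0.
by rewrite (negbTE (sum_theta_moment_neq _ _)).
Qed.

(** Partial fractions at [z = c * t ^ 2]. For [c > 0], [1 / (1 + c * t ^ 2)] is the Laplace
    characteristic function with [lam ^ 2 = 1 / c]; for [c = 0] it is that of the constant 0. *)
Lemma cauchy_functional_eq (c t : R) : 0 <= c ->
  \prod_(k < n) (((1 + c * (mu k * t) ^+ 2)^-1)%:C%C : R[i]) =
  \sum_(k < n) (theta mu k)%:C%C * ((1 + c * (mu k * t) ^+ 2)^-1)%:C%C.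
Proof.
move=> c0; have A0 : [set: 'I_n]%SET != finset.set0.
  by rewrite -card_gt0 cardsT card_ord; exact: ltnW.
have z0 : 0 <= c * t ^+ 2 by rewrite mulr_ge0// sqr_ge0.
have e k : 1 + c * (mu k * t) ^+ 2 = 1 + mu k ^+ 2 * (c * t ^+ 2) by ring.
rewrite -rmorph_prod/=; under [RHS]eq_bigr do rewrite -rmorphM/=.
rewrite -rmorph_sum/=; congr (_%:C)%C.
have := theta_on_partial_fractions mu_inj mu_gt0 A0 z0.
rewrite (eq_bigl xpredT); last by move=> k; rewrite inE.
rewrite [LHS](eq_bigl xpredT); last by move=> k; rewrite inE.
move=> h; under eq_bigr do rewrite e; rewrite -h.
by apply: eq_bigr => k _; rewrite theta_onT e.
Qed.
End Uniqueness.

(** * Expansions at 0, in particular of [1 / (1 + c * t ^ 2)] *)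

Section Expansions.
Context {R : realType}.

Lemma big_ord_double (V : zmodType) (F : nat -> V) k :
  \sum_(j < k.*2) F j = \sum_(j < k) (F j.*2 + F j.*2.+1).
Proof.
elim: k => [|k IH]; first by rewrite !big_ord0.
by rewrite doubleS !big_ord_recr/= IH addrA.
Qed.

(** Even truncation orders suffice: the truncations at [2 N] and at [N] differ by monomials of
    degree at least [N]. *)
Lemma bigO0_expansion (f : R -> R[i]) (a : nat -> R[i]) :
  (forall k, bigO0 k.*2 (fun t => f t - \sum_(j < k.*2) a j * t%:C%C ^+ j)) ->
  forall N, bigO0 N (fun t => f t - \sum_(j < N) a j * t%:C%C ^+ j).
Proof.
move=> h N.
have N2 : (N <= N.*2)%N by rewrite -addnn leq_addl.
have h1 := bigO0_le N2 (h N).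
have h2 : bigO0 N (fun t => \sum_(N <= j < N.*2) a j * t%:C%C ^+ j).
  rewrite (_ : (fun t => _) = fun t => \sum_(j <- index_iota N N.*2 | (N <= j)%N)
      a j * t%:C%C ^+ j); last first.
    apply/funext => t; rewrite big_nat_cond [RHS]big_seq_cond; apply: eq_bigl => j.
    by rewrite mem_index_iota andbT [RHS]andbC andbA andbb.
  by apply: bigO0_sum => j Nj; exact/bigO0Z/(bigO0_le Nj)/bigO0_monom.
apply: bigO0_eq (bigO0D h1 h2) => t.
rewrite -!(big_mkord xpredT (fun j => a j * t%:C%C ^+ j)).
by rewrite (big_cat_nat (leq0n N) N2)/=; ring.
Qed.

Lemma bigO0_real m (u : R -> R) (C : R) :
  (forall t, 0 <= t -> `|u t| <= C * t ^+ m) -> bigO0 m (fun t => (u t)%:C%C).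
Proof.
move=> h B; exists C => t /andP[t0 _].
by rewrite normc_def/= expr0n/= addr0 sqrtr_sqr lecR h.
Qed.

Lemma bigO0_ReIm m (u v : R -> R) :
  bigO0 m (fun t => (u t)%:C%C) -> bigO0 m (fun t => (v t)%:C%C) ->
  bigO0 m (fun t => (u t +i* v t)%C).
Proof.
move=> uO vO; apply: bigO0_eq (bigO0D uO (bigO0Z 'i%C vO)) => t.
by rewrite [RHS]complexE.
Qed.

(** A geometric series in [x = - c * t ^ 2]: the remainder after [k] terms is exactly
    [x ^ k / (1 + c * t ^ 2)]. *)
Lemma cauchy_expansion (c : R) : 0 <= c -> forall N,
  bigO0 N (fun t => ((1 + c * t ^+ 2)^-1)%:C%C -
    \sum_(j < N) (if odd j then 0 else (- c) ^+ j./2)%:C%C * t%:C%C ^+ j).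
Proof.
move=> c0; apply: (@bigO0_expansion (fun t => ((1 + c * t ^+ 2)^-1)%:C%C)
  (fun j => (if odd j then 0 else (- c) ^+ j./2)%:C%C)) => k.
apply: (@bigO0_eq _ _ (fun t => ((- (c * t ^+ 2)) ^+ k / (1 + c * t ^+ 2))%:C%C)); last first.
  apply: (@bigO0_real _ _ (c ^+ k)) => t t0.
  have z0 : 0 <= c * t ^+ 2 by rewrite mulr_ge0// sqr_ge0.
  have D0 : 0 <= (1 + c * t ^+ 2)^-1 by rewrite invr_ge0 addr_ge0.
  rewrite normrM normrX normrN (ger0_norm z0) (ger0_norm D0).
  rewrite exprMn -exprM mul2n ler_piMr ?mulr_ge0 ?exprn_ge0//.
  by rewrite invf_le1 ?lerDl ?ltr_pwDl.
move=> t.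
rewrite (big_ord_double (fun j => (if odd j then 0 else (- c) ^+ j./2)%:C%C * t%:C%C ^+ j)).
under eq_bigr => j _ do rewrite /= odd_double/= doubleK mul0r addr0 -rmorphXn -rmorphM/=.
rewrite -rmorph_sum/= -rmorphB/=; congr (_%:C)%C.
set x := - (c * t ^+ 2).
have -> : \sum_(j < k) (- c) ^+ j * t ^+ j.*2 = \sum_(j < k) x ^+ j.
  by apply: eq_bigr => j _; rewrite -mul2n exprM -exprMn mulNr.
have D : 1 + c * t ^+ 2 != 0 by rewrite gt_eqF// ltr_pwDl// mulr_ge0// sqr_ge0.
have := subrX1 x k; set S := \sum_(j < k) _ => h.
have -> : x ^+ k = 1 + (x - 1) * S by rewrite -h; ring.
by rewrite /x; field.
Qed.

End Expansions.


(** * Polynomial approximation at 0 from smoothness at 0 *)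

Section PeanoTaylor.
Context {R : realType}.

Lemma MVT_from0 (h dh : R -> R) (t : R) :
  (forall x : R, `|x| <= `|t| -> is_derive x 1 h (dh x)) ->
  exists2 c, `|c| <= `|t| & h t - h 0 = dh c * t.
Proof.
move=> hd.
have ch (a b : R) : (forall x, a <= x <= b -> `|x| <= `|t|) -> {within `[a, b], continuous h}.
  move=> ab; apply: derivable_within_continuous => x; rewrite in_itv/= => /ab/hd hx.
  exact: ex_derive.
have [t0|t0] := leP 0 t.
  have bd x : 0 <= x <= t -> `|x| <= `|t|.
    by move=> /andP[x0 xt]; rewrite !ger0_norm// (le_trans x0).
  have [|c] := @MVT_segment _ h dh 0 t t0 _ (ch _ _ bd).
    by move=> x; rewrite in_itv/= => /andP[x0 xt]; apply/hd/bd; rewrite !ltW.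
  by rewrite in_itv/= subr0 => /bd ct e; exists c.
have bd x : t <= x <= 0 -> `|x| <= `|t|.
  by move=> /andP[xt x0]; rewrite !ler0_norm ?lerN2// ltW.
have [|c] := @MVT_segment _ h dh t 0 (ltW t0) _ (ch _ _ bd).
  by move=> x; rewrite in_itv/= => /andP[xt x0]; apply/hd/bd; rewrite !ltW.
rewrite in_itv/= sub0r mulrN => /bd ct e; exists c => //.
by rewrite -[LHS]opprB e opprK.
Qed.

(** Induction on [N], applied to the derivative of [f]. Its polynomial is integrated, and the mean
    value theorem turns an error of order [N] for the derivative into one of order [N + 1] for
    [f]. *)
Lemma smooth_at0_taylor (f : R -> R) N : smooth_at0 f ->
  exists (p : {poly R}) (C delta : R), [/\ (size p <= N)%N, 0 < delta &
    forall t, `|t| <= delta -> `|f t - p.[t]| <= C * `|t| ^+ N].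
Proof.
elim: N f => [|N IH] f fs.
  have /nbhs_singleton/derivable1_diffP/differentiable_continuous cf := fs 0.
  have /cvgrPdist_le/(_ 1 ltr01) := cf.
  move=> /nbhs_ballP[e /= e0 eh].
  exists 0, (`|f 0| + 1), (e / 2); split=> [||t te]; rewrite ?size_poly0 ?divr_gt0//.
  rewrite horner0 subr0 expr0 mulr1 -lerBlDl (le_trans (lerB_dist _ _))// distrC.
  apply: eh; rewrite /ball/= sub0r normrN (le_lt_trans te)// ltr_pdivrMr//.
  by rewrite ltr_pMr// ltr1n.
have fs' : smooth_at0 f^`()%classic.
  move=> k; have := fs k.+1; apply: filterS => x.
  by rewrite derive1Sn.
have [p [C [e [sp e0 pC]]]] := IH _ fs'.
have /nbhs_ballP[e' /= e'0 df] := fs 0.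
(* The primitive of [p] with value [f 0] at 0. *)
pose q := (f 0)%:P + 'X * \poly_(i < N) (p`_i / i.+1%:R).
have q' : q^`() = p.
  apply/polyP => i; rewrite coef_deriv coefD coefC/= add0r coefXM/= coef_poly.
  case: ltnP => iN; last by rewrite mul0rn nth_default// (leq_trans sp).
  by rewrite -(mulr_natr (_ / _)) divfK// pnatr_eq0.
exists q, `|C|, (Num.min e (e' / 2)); split.
- apply/leq_sizeP => j Nj; rewrite coefD coefC coefXM coef_poly.
  by case: j Nj => [//|j]; rewrite ltnS /= leqNgt => /negbTE ->; rewrite addr0.
- by rewrite lt_min e0 divr_gt0.
move=> t; rewrite le_min => /andP[te te'].
have dfx (x : R) : `|x| <= `|t| -> is_derive x 1 f (f^`()%classic x).
  move=> xt; rewrite derive1E; apply/derivableP/df.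
  rewrite /ball/= sub0r normrN (le_lt_trans xt)// (le_lt_trans te')//.
  by rewrite ltr_pdivrMr// ltr_pMr// ltr1n.
have [|c ct] := @MVT_from0 (fun x => f x - q.[x]) (fun x => f^`()%classic x - p.[x]) t.
  by move=> x /dfx fx; rewrite -q'; apply: is_deriveB.
have -> : f 0 - q.[0] = 0 by rewrite /q !hornerE subrr.
rewrite subr0 => ->; rewrite normrM exprS mulrCA mulrC ler_wpM2l//.
apply: (le_trans (pC _ (le_trans ct te))).
rewrite (le_trans (ler_wpM2r _ (ler_norm C))) ?exprn_ge0//.
by rewrite ler_wpM2l// lerXn2r ?nnegrE.
Qed.

(** Once the coefficients below [m] are known to vanish, [p = 'X^m * q], and the quotient tends to
    the constant coefficient of [q]. *)
Lemma poly_little_o_coef (p : {poly R}) m :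
  p.[n.+1%:R^-1] / n.+1%:R^-1 ^+ m @[n --> \oo] --> 0 ->
  forall i, (i <= m)%N -> p`_i = 0.
Proof.
have inv0 : n.+1%:R^-1 @[n --> \oo] --> (0 : R) by exact: cvg_harmonic.
have inv_neq0 n : n.+1%:R^-1 != 0 :> R by rewrite invr_eq0 pnatr_eq0.
have p0 (q : {poly R}) : q.[n.+1%:R^-1] @[n --> \oo] --> q`_0.
  rewrite -horner_coef0; apply: (cvg_comp _ _ inv0); exact: continuous_horner.
elim: m => [|m IH] h.
  move=> i; rewrite leqn0 => /eqP ->.
  apply: (cvg_unique _ (p0 p)) => //.
  apply: cvg_trans h; apply: near_eq_cvg; apply: nearW => n.
  by rewrite expr0 divr1.
have {}IH i : (i <= m)%N -> p`_i = 0.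
  have h' : n.+1%:R^-1 * (p.[n.+1%:R^-1] / n.+1%:R^-1 ^+ m.+1) @[n --> \oo] --> (0 : R).
    by rewrite -[X in _ --> X](mulr0 (0 : R)); exact: cvgM.
  apply: IH; apply: cvg_trans h'.
  apply: near_eq_cvg; apply: nearW => n.
  by rewrite /= exprS invfM mulrCA mulVKf ?inv_neq0.
move=> i; rewrite leq_eqVlt => /predU1P[->|]; last exact: IH.
have pE : p = drop_poly m.+1 p * 'X^(m.+1).
  rewrite -[LHS](poly_take_drop m.+1) (_ : take_poly _ _ = 0) ?add0r//.
  by apply/polyP => j; rewrite coef_take_poly coef0; case: ltnP => // /IH.
have -> : p`_m.+1 = (drop_poly m.+1 p)`_0 by rewrite coef_drop_poly.
apply: (cvg_unique _ (p0 _)) => //.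
apply: cvg_trans h; apply: near_eq_cvg; apply: nearW => n.
by rewrite [in LHS]pE hornerM hornerXn mulfK// expf_neq0.
Qed.

End PeanoTaylor.

(** * Linearity, comparison and dominated convergence for weighted integrals *)

(* [wint m X w h] is the expectation of [h X] when [w = 1], and the integral of [h]
   against the density [w] when [X] is the identity. *)
Section WeightedIntegral.
Context {d} {T : measurableType d} {R : realType} (m : {measure set T -> \bar R}).
Variables (X w : T -> R).
Hypotheses (mX : measurable_fun [set: T] X) (mw : measurable_fun [set: T] w).
Hypothesis (w0 : forall x, 0 <= w x).
Implicit Types (h g : R -> R).

Definition wintegrable h := m.-integrable [set: T] (fun x => (h (X x) * w x)%:E).
Definition wint h : R := \int[m]_x (h (X x) * w x).

Lemma measurable_wfun h : measurable_fun [set: R] h ->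
  measurable_fun [set: T] (fun x => (h (X x) * w x)%:E).
Proof.
move=> mh; apply/measurable_EFinP; apply: measurable_funM => //.
exact: measurableT_comp.
Qed.

Lemma wintegrableD h g : wintegrable h -> wintegrable g ->
  wintegrable (fun x => h x + g x).
Proof.
move=> ih ig; apply: eq_integrable (integrableD _ ih ig) => // x _.
by rewrite /= mulrDl EFinD.
Qed.

Lemma wintegrableZ (a : R) h : wintegrable h -> wintegrable (fun x => a * h x).
Proof.
move=> ih; apply: eq_integrable (integrableZl _ a ih) => // x _.
by rewrite /= -mulrA EFinM.
Qed.

Lemma wintD h g : wintegrable h -> wintegrable g ->
  wint (fun x => h x + g x) = wint h + wint g.
Proof.
move=> ih ig; rewrite /wint -RintegralD//.
by apply: eq_Rintegral => x _; rewrite mulrDl.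
Qed.

Lemma wintZ (a : R) h : wintegrable h -> wint (fun x => a * h x) = a * wint h.
Proof.
move=> ih; rewrite /wint -RintegralZl//.
by apply: eq_Rintegral => x _; rewrite mulrA.
Qed.

Lemma wintegrableB h g : wintegrable h -> wintegrable g ->
  wintegrable (fun x => h x - g x).
Proof.
move=> ih /(wintegrableZ (-1)) ig.
by under eq_fun do rewrite -mulN1r; exact: wintegrableD.
Qed.

Lemma wintB h g : wintegrable h -> wintegrable g ->
  wint (fun x => h x - g x) = wint h - wint g.
Proof.
move=> ih ig; rewrite -mulN1r -wintZ// -wintD//; last exact: wintegrableZ.
by apply: eq_Rintegral => x _; rewrite mulN1r.
Qed.

Lemma wintegrable0 : wintegrable (fun=> 0).
Proof.
by apply: eq_integrable (integrable0 m [set: T]) => // x _; rewrite mul0r.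
Qed.

Lemma wint0 : wint (fun=> 0) = 0.
Proof.
rewrite -[RHS](mul0r (wint (fun=> 0))) -(wintZ 0 wintegrable0).
by apply: eq_Rintegral => x _; rewrite !mul0r.
Qed.

Lemma wintegrable_sum n (F : 'I_n -> R -> R) : (forall i, wintegrable (F i)) ->
  wintegrable (fun x => \sum_(i < n) F i x).
Proof.
move=> h; rewrite (_ : (fun x => _) = \sum_(i < n) F i); last first.
  by apply/funext => x; rewrite fct_sumE.
elim/big_ind : _ => //; first exact: wintegrable0.
by move=> f g; exact: wintegrableD.
Qed.

Lemma wint_sum n (F : 'I_n -> R -> R) : (forall i, wintegrable (F i)) ->
  wint (fun x => \sum_(i < n) F i x) = \sum_(i < n) wint (F i).
Proof.
elim: n F => [|n IH] F h.
  rewrite big_ord0 -[RHS]wint0; congr wint.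
  by apply/funext => x; rewrite big_ord0.
rewrite big_ord_recl -IH// -wintD//; last exact: wintegrable_sum.
by congr wint; apply/funext => x; rewrite big_ord_recl.
Qed.

Lemma wintegrable_le h g : measurable_fun [set: R] h ->
  (forall x, `|h x| <= g x) -> wintegrable g -> wintegrable h.
Proof.
move=> mh hg ig; apply: le_integrable ig => //; first exact: measurable_wfun.
move=> x _; rewrite /= lee_fin !normrM ler_wpM2r//.
by rewrite (le_trans (hg _))// ler_norm.
Qed.

Lemma wint_le h g : wintegrable h -> wintegrable g ->
  (forall x, h x <= g x) -> wint h <= wint g.
Proof.
move=> ih ig hg; apply: le_Rintegral => // x _.
by rewrite ler_wpM2r.
Qed.

Lemma wint_ge0 h : (forall x, 0 <= h x) -> 0 <= wint h.
Proof. by move=> h0; apply: Rintegral_ge0 => x _; rewrite mulr_ge0. Qed.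

Lemma wint_norm_le h g : wintegrable h -> wintegrable g ->
  (forall x, `|h x| <= g x) -> `|wint h| <= wint g.
Proof.
move=> ih ig hg; rewrite ler_norml -mulN1r -wintZ//.
by apply/andP; split; apply: wint_le => //; try exact: wintegrableZ;
  move=> x; have := hg x; rewrite ler_norml ?mulN1r => /andP[].
Qed.

Lemma wint_dominated (h_ : nat -> R -> R) h g :
  (forall n, measurable_fun [set: R] (h_ n)) -> measurable_fun [set: R] h ->
  (forall x, h_ n x @[n --> \oo] --> h x) ->
  (forall n x, `|h_ n x| <= g x) -> wintegrable g ->
  wintegrable h /\ wint (h_ n) @[n --> \oo] --> wint h.
Proof.
move=> mh_ mh hh hg ig.
have [ih _ c] : [/\ m.-integrable [set: T] (fun x => (h (X x) * w x)%:E),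
   [sequence (\int[m]_x `|(h_ n (X x) * w x)%:E - (h (X x) * w x)%:E|)%E]_n @ \oo --> 0%E &
   [sequence (\int[m]_x (h_ n (X x) * w x)%:E)%E]_n @ \oo --> (\int[m]_x (h (X x) * w x)%:E)%E].
  apply: (dominated_convergence _ _ _ _ ig) => //.
  - by move=> n; exact: measurable_wfun.
  - exact: measurable_wfun.
  - apply: aeW => x _; apply: cvg_EFin; first exact: nearW.
    by apply: cvgM; [exact: hh|exact: cvg_cst].
  - apply: aeW => x n _; rewrite lee_fin normrM (ger0_norm (w0 x)).
    by rewrite ler_wpM2r.
split => //; apply: fine_cvg; rewrite fineK//.
exact: integrable_fin_num.
Qed.

End WeightedIntegral.

(** * Smoothness at 0 gives finite moments, and finite moments give the expansion at 0 *)

Section SmoothMoments.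
Context {d} {T : measurableType d} {R : realType} (m : {measure set T -> \bar R}).
Variables (X w : T -> R).
Hypotheses (mX : measurable_fun [set: T] X) (mw : measurable_fun [set: T] w).
Hypothesis (w0 : forall x, 0 <= w x).
Local Notation WI := (wintegrable m X w).
Local Notation J := (wint m X w).

(** Fatou's lemma as an integrability criterion: a uniform bound on the integrals of nonnegative
    approximations passes to their pointwise limit. *)
Lemma wintegrable_fatou (h_ : nat -> R -> R) (h : R -> R) (C : R) :
  (forall n, measurable_fun [set: R] (h_ n)) -> measurable_fun [set: R] h ->
  (forall n x, 0 <= h_ n x) -> (forall x, 0 <= h x) ->
  (forall x, h_ n x @[n --> \oo] --> h x) ->
  (forall n, WI (h_ n)) -> (forall n, J (h_ n) <= C) -> WI h.
Proof.
move=> mh_ mh h0 h0' hh ih hC.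
apply/integrableP; split; first exact: measurable_wfun.
have -> : (\int[m]_x `|(h (X x) * w x)%:E| =
    \int[m]_x limn_einf (fun n => (h_ n (X x) * w x)%:E))%E.
  apply: eq_integral => x _; rewrite gee0_abs ?lee_fin ?mulr_ge0//.
  have c : (h_ n (X x) * w x)%:E @[n --> \oo] --> (h (X x) * w x)%:E.
    apply: cvg_EFin; first exact: nearW.
    by apply: cvgM; [exact: hh|exact: cvg_cst].
  rewrite is_cvg_limn_einfE; last by apply/cvg_ex; eexists; exact: c.
  by apply/esym/cvg_lim.
apply: (@le_lt_trans _ _ (limn_einf (fun n => \int[m]_x (h_ n (X x) * w x)%:E)%E)).
  apply: fatou => //; first by move=> n; exact: measurable_wfun.
  by move=> n x _; rewrite lee_fin mulr_ge0.
apply: (@le_lt_trans _ _ C%:E); last exact: ltry.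
rewrite limn_einf_lim; apply: lime_le; first exact: is_cvg_einfs.
apply: nearW => n; apply: (@le_trans _ _ (\int[m]_x (h_ n (X x) * w x)%:E)%E).
  by apply: ereal_inf_lbound; exists n => //=.
rewrite -[leLHS]fineK ?lee_fin; first exact: hC.
exact: integrable_fin_num (ih n).
Qed.

Hypothesis i1 : WI (fun=> 1).

Lemma measurable_cosM (t : R) : measurable_fun [set: R] (fun x : R => cos (t * x)).
Proof.
apply: measurableT_comp; last exact: mulrl_measurable.
by apply: continuous_measurable_fun; exact: continuous_cos.
Qed.

Lemma measurable_sinM (t : R) : measurable_fun [set: R] (fun x : R => sin (t * x)).
Proof.
apply: measurableT_comp; last exact: mulrl_measurable.
by apply: continuous_measurable_fun; exact: continuous_sin.
Qed.

Lemma wintegrable_cos (t : R) : WI (fun x => cos (t * x)).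
Proof.
apply: (wintegrable_le mX mw _ _ i1) => //; first exact: measurable_cosM.
by move=> x; exact: cos_max.
Qed.

Lemma wintegrable_sin (t : R) : WI (fun x => sin (t * x)).
Proof.
apply: (wintegrable_le mX mw _ _ i1) => //; first exact: measurable_sinM.
by move=> x; exact: sin_max.
Qed.

Lemma wintegrable_pow_le k j : (j <= k.*2)%N ->
  WI (fun x => x ^+ k.*2) -> WI (fun x => x ^+ j).
Proof.
move=> jk ik; apply: (wintegrable_le mX mw _ _ (wintegrableD i1 ik)) => //.
move=> x; rewrite normrX -[x ^+ _]ger0_norm; last by rewrite -mul2n exprM exprn_ge0// sqr_ge0.
rewrite normrX; have [x1|x1] := leP `|x| 1.
  by rewrite -[leLHS]addr0 lerD ?exprn_ge0// exprn_ile1.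
rewrite -[leLHS]add0r lerD//.
by rewrite ler_weXn2l// ltW.
Qed.

Lemma wintegrable_cosT k (t : R) : (forall j, (j < k)%N -> WI (fun x => x ^+ j.*2)) ->
  WI (fun x => cosT k (t * x)).
Proof.
move=> ij; apply: wintegrable_sum => j.
rewrite (_ : (fun x => _) = (fun x => ((-1) ^+ j * t ^+ j.*2 / (j.*2)`!%:R) * x ^+ j.*2)).
  exact/wintegrableZ/ij.
by apply/funext => x; rewrite exprMn; ring.
Qed.

Lemma wint_cosT k (t : R) : (forall j, (j < k)%N -> WI (fun x => x ^+ j.*2)) ->
  J (fun x => cosT k (t * x)) =
  \sum_(j < k) ((-1) ^+ j * J (fun x => x ^+ j.*2) / (j.*2)`!%:R) * t ^+ j.*2.
Proof.
move=> ij.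
have E (j : 'I_k) : (fun x => (-1) ^+ j * (t * x) ^+ j.*2 / (j.*2)`!%:R) =
    (fun x => ((-1) ^+ j * t ^+ j.*2 / (j.*2)`!%:R) * x ^+ j.*2).
  by apply/funext => x; rewrite exprMn; ring.
rewrite wint_sum; last by move=> j; rewrite E; exact/wintegrableZ/ij.
by apply: eq_bigr => j _; rewrite E wintZ ?ij//; ring.
Qed.

Let rem k (y : R) := (-1) ^+ k * (cos y - cosT k y).

(** A domination that costs only the moment of order [2 k]: the remainder after [k + 1] terms is the
    term of degree [2 k] minus the remainder after [k] terms, which is no larger than that term in
    absolute value. *)
Let rem_le2 k y : rem k.+1 y <= y ^+ k.*2 / (k.*2)`!%:R *+ 2.
Proof.
rewrite /rem; have := cos_taylor_rec k y.
have := cos_taylor_bound k y.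
have -> : `|cos y - cosT k y| = `|(-1) ^+ k * (cos y - cosT k y)|.
  by rewrite normrM normrX normrN1 expr1n mul1r.
by rewrite ler_norml mulr2n => /andP[+ _]; lra.
Qed.

Let measurable_rem k t : measurable_fun [set: R] (fun x => rem k.+1 (t * x)).
Proof.
apply: measurableT_comp; last exact: mulrl_measurable.
apply: measurable_funM => //; apply: measurable_funB.
  by apply: continuous_measurable_fun; exact: continuous_cos.
apply: continuous_measurable_fun.
exact: (is_derive_continuous (is_derive_cosT k)).
Qed.

(** Let [F t] be the integral of the signed cosine remainder. It is [o(t ^ (2k))] by dominated
    convergence and, by smoothness, a polynomial up to [O(t ^ (2k + 2))]. Only a term in
    [t ^ (2k + 1)] can remain, and parity removes it, so [F t = O(t ^ (2k + 2))] and Fatou's lemma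
    applies to the integrand over [t ^ (2k + 2)]. *)
Lemma wintegrable_even_moment_step k :
  smooth_at0 (fun t => J (fun x => cos (t * x))) ->
  WI (fun x => x ^+ k.*2) -> WI (fun x => x ^+ k.+1.*2).
Proof.
move=> us ik.
have ij j : (j < k.+1)%N -> WI (fun x => x ^+ j.*2).
  by rewrite ltnS => jk; apply: wintegrable_pow_le ik; rewrite leq_double.
have iF t : WI (fun x => rem k.+1 (t * x)).
  apply/wintegrableZ/wintegrableB; first exact: wintegrable_cos.
  exact: wintegrable_cosT.
pose F t := J (fun x => rem k.+1 (t * x)).
pose Q : {poly R} := \sum_(j < k.+1) ((-1) ^+ j * J (fun x => x ^+ j.*2) / (j.*2)`!%:R) *: 'X^(j.*2).
have FE t : F t = (-1) ^+ k.+1 * (J (fun x => cos (t * x)) - Q.[t]).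
  rewrite /F wintZ; last first.
    by apply: wintegrableB; [exact: wintegrable_cos|exact: wintegrable_cosT].
  rewrite wintB ?wint_cosT//; [|exact: wintegrable_cos|exact: wintegrable_cosT].
  rewrite /Q horner_sum; congr (_ * (_ - _)); apply: eq_bigr => j _.
  by rewrite hornerZ hornerXn.
have FN t : F (- t) = F t.
  by congr wint; apply/funext => x; rewrite /rem mulNr cosN cosTN.
have F0 t : 0 <= F t by apply: wint_ge0 => // x; exact: cos_taylor_ge0.
have [p [C [delta [sp d0 pC]]]] := smooth_at0_taylor k.+1.*2 us.
pose D := (-1) ^+ k.+1 *: (p - Q).
have FD t : `|t| <= delta -> `|F t - D.[t]| <= C * `|t| ^+ k.+1.*2.
  move=> /pC; rewrite FE /D hornerZ hornerD hornerN -mulrBr normrM normrX normrN1.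
  by rewrite expr1n mul1r opprB addrA subrK.
pose t_ n : R := n.+1%:R^-1.
have t_gt0 n : 0 < t_ n by rewrite invr_gt0 ltr0n.
have t_cvg : t_ n @[n --> \oo] --> (0 : R) by exact: cvg_harmonic.
have even0 (x : R) j : 0 <= x ^+ j.*2 by rewrite -mul2n exprM exprn_ge0// sqr_ge0.
have t2_cvg (a : R) : a * t_ n ^+ 2 @[n --> \oo] --> (0 : R).
  rewrite -[X in _ --> X](mulr0 a); apply: cvgM; first exact: cvg_cst.
  by rewrite -[X in _ --> X](mulr0 (0 : R)); apply: cvgM.
have tk_gt0 n j : 0 < t_ n ^+ j by rewrite exprn_gt0.
have eqle (a b : R) : a = b -> a <= b by move=> ->.
have nt n : `|t_ n| = t_ n by rewrite gtr0_norm.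
(* Dominated convergence: after division by [t ^ (2k)] the integrand tends to 0 pointwise and stays
   below [2 * x ^ (2k) / (2k)!]. *)
have F_cvg : (t_ n ^+ k.*2)^-1 * F (t_ n) @[n --> \oo] --> (0 : R).
  have [|||||_] := @wint_dominated _ _ _ m X w mX mw w0
      (fun n x => (t_ n ^+ k.*2)^-1 * rem k.+1 (t_ n * x)) (fun=> 0)
      (fun x => (k.*2)`!%:R^-1 *+ 2 * x ^+ k.*2); last 1 first.
  - rewrite wint0; apply: cvg_trans; apply: near_eq_cvg; apply: nearW => n.
    by rewrite wintZ.
  - by move=> n; apply: measurable_funM => //; exact: measurable_rem.
  - by [].
  - move=> x; apply: (@squeeze_cvgr _ _ _ _ (fun=> 0) (fun n =>
        (x ^+ k.+1.*2 / (k.+1.*2)`!%:R) * t_ n ^+ 2)).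
    + apply: nearW => n; apply/andP; split.
        by rewrite mulr_ge0 ?cos_taylor_ge0// invr_ge0 ltW.
      rewrite ler_pdivrMl//; apply: (le_trans (cos_taylor_le _ _)).
      rewrite exprMn doubleS !exprS; apply: eqle; ring.
    + exact: cvg_cst.
    + exact: t2_cvg.
  - move=> n x; rewrite ger0_norm; last first.
      by rewrite mulr_ge0 ?cos_taylor_ge0// invr_ge0 ltW.
    rewrite ler_pdivrMl//; apply: (le_trans (rem_le2 _ _)).
    by rewrite exprMn; apply: eqle; ring.
  - exact: wintegrableZ.
have t_small : \forall n \near \oo, t_ n <= delta.
  have /cvgrPdist_le/(_ _ d0) := t_cvg; apply: filterS => n.
  by rewrite sub0r normrN ger0_norm// ltW.
have DF_cvg : D.[t_ n] / t_ n ^+ k.*2 @[n --> \oo] --> (0 : R).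
  have h : (t_ n ^+ k.*2)^-1 * (F (t_ n) - D.[t_ n]) @[n --> \oo] --> (0 : R).
    apply/norm_cvg0P; apply: (@squeeze_cvgr _ _ _ _ (fun=> 0) (fun n => `|C| * t_ n ^+ 2)).
    - apply: filterS t_small => n tn; rewrite normr_ge0/= normrM.
      rewrite ger0_norm ?invr_ge0 ?(ltW (tk_gt0 _ _))// ler_pdivrMl//.
      have := FD (t_ n); rewrite nt => /(_ tn) /le_trans; apply.
      rewrite doubleS -addn2 exprD mulrCA ler_wpM2l ?(ltW (tk_gt0 _ _))//.
      by rewrite ler_wpM2r ?(ltW (tk_gt0 _ _))// ler_norm.
    - exact: cvg_cst.
    - exact: t2_cvg.
  have {}h : (t_ n ^+ k.*2)^-1 * F (t_ n) - (t_ n ^+ k.*2)^-1 * (F (t_ n) - D.[t_ n])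
      @[n --> \oo] --> (0 : R).
    by rewrite -[X in _ --> X](subr0 (0 : R)); exact: cvgB.
  by apply: cvg_trans h; apply: near_eq_cvg; apply: nearW => n; ring.
have D0 := poly_little_o_coef DF_cvg.
(* Coefficients up to [2 k] vanish by [D0]; those from [2 k + 2] on vanish because [p] has size at
   most [2 k + 2] and [Q] has degree at most [2 k]. *)
have DE : D = D`_k.*2.+1 *: 'X^(k.*2.+1).
  apply/polyP => i; rewrite coefZ coefXn; have [->|ik'] := eqVneq i k.*2.+1.
    by rewrite mulr1.
  rewrite mulr0; have [/D0//|] := leqP i k.*2.
  rewrite leq_eqVlt eq_sym (negbTE ik')/= => ki.
  rewrite coefZ coefD coefN nth_default ?sub0r ?(leq_trans sp)// coef_sum big1 ?oppr0 ?mulr0//.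
  move=> j _; rewrite coefZ coefXn gtn_eqF ?mulr0//.
  by apply: leq_ltn_trans ki; rewrite ltnW// ltnS leq_double -ltnS.
have DN t : D.[- t] = - D.[t].
  rewrite DE !hornerZ !hornerXn exprNn -signr_odd oddS odd_double expr1; ring.
(* [F] is even and [D] is odd, so averaging the estimates at [t] and [- t] eliminates [D]. *)
have FC t : `|t| <= delta -> F t <= C * `|t| ^+ k.+1.*2.
  move=> td; have h1 := FD _ td; have := FD (- t); rewrite normrN FN DN => /(_ td).
  by move: h1; rewrite !ler_norml; lra.
have [N _ Nt] := t_small.
apply: (@eq_integrable _ _ _ m setT _ (fun x =>
   (((k.+1.*2)`!%:R * (X x ^+ k.+1.*2 / (k.+1.*2)`!%:R)) * w x)%:E)) => //.
  by move=> x _; rewrite [_%:R * _]mulrC divfK// pnatr_eq0 -lt0n fact_gt0.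
apply: (@wintegrableZ _ _ _ m X w _ (fun x => x ^+ k.+1.*2 / (k.+1.*2)`!%:R)).
(* The shift by [N] keeps every [t_ (n + N)] within [delta], where [FC] holds. *)
apply: (@wintegrable_fatou (fun n x => (t_ (n + N)%N ^+ k.+1.*2)^-1 *
  rem k.+1 (t_ (n + N)%N * x)) _ C).
- by move=> n; apply: measurable_funM => //; exact: measurable_rem.
- by apply: measurable_funM => //; exact: exprn_measurable.
- by move=> n x; rewrite mulr_ge0 ?cos_taylor_ge0// invr_ge0 ltW.
- by move=> x; rewrite divr_ge0.
(* The two bounds are [cos_taylor_ge] and [cos_taylor_le] divided by [t ^ (2k + 2)]. *)
- move=> x; apply: (@squeeze_cvgr _ _ _ _ (fun n => x ^+ k.+1.*2 / (k.+1.*2)`!%:R -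
    (x ^+ k.+2.*2 / (k.+2.*2)`!%:R) * t_ (n + N)%N ^+ 2) (fun=> x ^+ k.+1.*2 / (k.+1.*2)`!%:R)).
  + apply: nearW => n; rewrite ler_pdivlMl// ler_pdivrMl//; apply/andP; split; last first.
      by apply: (le_trans (cos_taylor_le _ _)); rewrite exprMn -mulrA.
    apply: le_trans (cos_taylor_ge _ _); rewrite !exprMn (doubleS k.+1) !exprS.
    by apply: eqle; ring.
  + rewrite -[X in _ --> X]subr0; apply: cvgB; first exact: cvg_cst.
    exact: (cvg_comp _ _ (cvg_addnr N) (t2_cvg _)).
  + exact: cvg_cst.
- by move=> n; exact: wintegrableZ.
- move=> n; rewrite wintZ// ler_pdivrMl// mulrC.
  have tN : t_ (n + N)%N <= delta by apply: Nt; rewrite /= leq_addl.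
  by have := FC (t_ (n + N)%N); rewrite nt; exact.
Qed.

Lemma wintegrable_pow j :
  smooth_at0 (fun t => J (fun x => cos (t * x))) -> WI (fun x => x ^+ j).
Proof.
move=> us; have ie k : WI (fun x => x ^+ k.*2).
  elim: k => [|k IH]; first by under eq_fun do rewrite expr0.
  exact: wintegrable_even_moment_step.
by apply: wintegrable_pow_le (ie j); rewrite -addnn leq_addl.
Qed.

Hypothesis ipow : forall j, WI (fun x => x ^+ j).

Lemma wintegrable_normX j : WI (fun x => `|x| ^+ j).
Proof.
apply: eq_integrable (integrable_norm (ipow j)) => // x _.
by rewrite /= normrM normrX (ger0_norm (w0 x)).
Qed.

Lemma wintegrable_sinT k (t : R) : WI (fun x => sinT k (t * x)).
Proof.
apply: wintegrable_sum => j.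
rewrite (_ : (fun x => _) = (fun x => ((-1) ^+ j * t ^+ j.*2.+1 / (j.*2.+1)`!%:R) * x ^+ j.*2.+1)).
  exact/wintegrableZ/ipow.
by apply/funext => x; rewrite exprMn; ring.
Qed.

Lemma wint_sinT k (t : R) : J (fun x => sinT k (t * x)) =
  \sum_(j < k) ((-1) ^+ j * J (fun x => x ^+ j.*2.+1) / (j.*2.+1)`!%:R) * t ^+ j.*2.+1.
Proof.
have E (j : 'I_k) : (fun x => (-1) ^+ j * (t * x) ^+ j.*2.+1 / (j.*2.+1)`!%:R) =
    (fun x => ((-1) ^+ j * t ^+ j.*2.+1 / (j.*2.+1)`!%:R) * x ^+ j.*2.+1).
  by apply/funext => x; rewrite exprMn; ring.
rewrite wint_sum; last by move=> j; rewrite E; exact/wintegrableZ/ipow.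
by apply: eq_bigr => j _; rewrite E wintZ//; ring.
Qed.

(* [(if odd j then 'i else 1) * (-1) ^+ j./2 = 'i ^+ j] *)
Definition char_coef j : R[i] :=
  ((-1) ^+ j./2 * J (fun x => x ^+ j) / j`!%:R)%:C%C * (if odd j then 'i%C else 1).

(** Integrating the pointwise Taylor bounds turns the remainders into absolute moments times powers
    of [t]. Cosine supplies the even coefficients and sine the odd ones. *)
Lemma wint_cos_sin_expansion N :
  bigO0 N (fun t => (J (fun x => cos (t * x)) +i* J (fun x => sin (t * x)))%C -
                    \sum_(j < N) char_coef j * t%:C%C ^+ j).
Proof.
move: N; apply: (@bigO0_expansion _ (fun t =>
  (J (fun x => cos (t * x)) +i* J (fun x => sin (t * x)))%C)) => k.
apply: (@bigO0_eq _ _ (fun t =>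
  (J (fun x => cos (t * x) - cosT k (t * x)) +i* J (fun x => sin (t * x) - sinT k (t * x)))%C)).
  move=> t; rewrite (big_ord_double (fun j => char_coef j * t%:C%C ^+ j)).
  rewrite !wintB; [|exact: wintegrable_sin|exact: wintegrable_sinT
    |exact: wintegrable_cos|by apply: wintegrable_cosT].
  rewrite wint_cosT// wint_sinT.
  have E (j : 'I_k) : char_coef j.*2 * t%:C%C ^+ j.*2 + char_coef j.*2.+1 * t%:C%C ^+ j.*2.+1 =
     ((-1) ^+ j * J (fun x => x ^+ j.*2) / (j.*2)`!%:R * t ^+ j.*2)%:C%C +
     'i%C * ((-1) ^+ j * J (fun x => x ^+ j.*2.+1) / (j.*2.+1)`!%:R * t ^+ j.*2.+1)%:C%C.
    rewrite /char_coef/= odd_double/= doubleK uphalf_double mulr1 -rmorphXn -rmorphM/=.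
    by rewrite [in RHS](rmorphM _ _ (t ^+ _.+1))/= rmorphXn/=; ring.
  rewrite (eq_bigr _ (fun j _ => E j)) big_split/= -mulr_sumr -!rmorph_sum/=.
  by apply/eqP; rewrite eq_complex/=; apply/andP; split; apply/eqP; ring.
apply: bigO0_ReIm.
  apply: (@bigO0_real _ _ _ (J (fun x => x ^+ k.*2) / (k.*2)`!%:R)) => t t0.
  rewrite [leRHS](_ : _ = J (fun x => t ^+ k.*2 / (k.*2)`!%:R * x ^+ k.*2)); last first.
    by rewrite wintZ//; ring.
  apply: wint_norm_le => //.
  - by apply: wintegrableB; [exact: wintegrable_cos|exact: wintegrable_cosT].
  - exact: wintegrableZ.
  - by move=> x; rewrite (le_trans (cos_taylor_bound _ _))// exprMn mulrAC.
apply: (@bigO0_le _ _ k.*2.+1) => //.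
apply: (@bigO0_real _ _ _ (J (fun x => `|x| ^+ k.*2.+1) / (k.*2.+1)`!%:R)) => t t0.
rewrite [leRHS](_ : _ = J (fun x => t ^+ k.*2.+1 / (k.*2.+1)`!%:R * `|x| ^+ k.*2.+1)); last first.
  by rewrite wintZ//; [ring|exact: wintegrable_normX].
apply: wint_norm_le => //.
- by apply: wintegrableB; [exact: wintegrable_sin|exact: wintegrable_sinT].
- exact/wintegrableZ/wintegrable_normX.
- move=> x; rewrite (le_trans (sin_taylor_bound _ _))// normrM exprMn mulrAC.
  by rewrite (ger0_norm t0).
Qed.

End SmoothMoments.

(** * Absolute moments of odd order from even moments *)

Section AbsoluteMoments.
Context {d} {T : measurableType d} {R : realType} (m : {measure set T -> \bar R}).
Variables (X w : T -> R) (a : R).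
Hypotheses (mX : measurable_fun [set: T] X) (mw : measurable_fun [set: T] w).
Hypotheses (w0 : forall x, 0 <= w x) (a0 : 0 < a).
Hypothesis ipow : forall j, wintegrable m X w (fun x => x ^+ j).
Hypothesis moment_le : forall k, wint m X w (fun x => x ^+ k.*2) <= (k.*2)`!%:R * a ^+ k.*2.

(** An odd order is bounded by its two even neighbours through [2 * a * |x| <= a ^ 2 + x ^ 2]. The
    factorial of [j + 1] instead of [j] pays for the even order above. *)
Lemma abs_moment_le j : wint m X w (fun x => `|x| ^+ j) <= (j.+1)`!%:R * a ^+ j.
Proof.
have even (x : R) k : `|x| ^+ k.*2 = x ^+ k.*2.
  by rewrite -normrX ger0_norm// -mul2n exprM exprn_ge0// sqr_ge0.
have fact_le k p : (k <= p)%N -> (k`!%:R : R) <= p`!%:R.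
  move=> /subnKC <-; rewrite ler_nat; elim: (p - k)%N => [|q IH]; first by rewrite addn0.
  by rewrite addnS factS (leq_trans IH)// leq_pmull.
have [k [->|->]] : exists k, j = k.*2 \/ j = k.*2.+1.
  by exists j./2; rewrite -{1 3}(odd_double_half j); case: odd; [right|left].
- rewrite (_ : wint m X w _ = wint m X w (fun x => x ^+ k.*2)).
    apply: (le_trans (moment_le k)); rewrite ler_wpM2r ?exprn_ge0 ?(ltW a0)//.
    exact: fact_le.
  by congr wint; apply/funext => x; rewrite even.
have i1 := wintegrableZ (a / 2) (ipow k.*2).
have i2 := wintegrableZ (a^-1 / 2) (ipow k.+1.*2).
apply: (@le_trans _ _ (wint m X w (fun x => a / 2 * x ^+ k.*2 + a^-1 / 2 * x ^+ k.+1.*2))).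
  apply: wint_le => //; first exact: wintegrable_normX.
    exact: wintegrableD.
  move=> x; rewrite -(even x k) -(even x k.+1) doubleS !exprS.
  have := normr_ge0 x; move: `|x| => y y0.
  have : 0 <= y ^+ k.*2 by rewrite exprn_ge0.
  move: (y ^+ k.*2) => z z0.
  have -> : a / 2 * z + a^-1 / 2 * (y * (y * z)) = a^-1 / 2 * z * (a ^+ 2 + y ^+ 2).
    by field; rewrite gt_eqF.
  have -> : y * z = a^-1 / 2 * z * (a * y *+ 2) by field; rewrite gt_eqF.
  rewrite ler_wpM2l//; first by rewrite mulr_ge0// divr_ge0// invr_ge0 ltW.
  by rewrite -subr_ge0 -addrAC -sqrrB sqr_ge0.
rewrite wintD ?wintZ//.
apply: (@le_trans _ _ (a / 2 * ((k.*2)`!%:R * a ^+ k.*2) +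
                       a^-1 / 2 * ((k.+1.*2)`!%:R * a ^+ k.+1.*2))).
  by apply: lerD; rewrite ler_wpM2l// divr_ge0// ?invr_ge0 ltW.
rewrite -doubleS (_ : _ + _ = ((k.*2)`!%:R + (k.+1.*2)`!%:R) / 2 * a ^+ k.*2.+1); last first.
  by rewrite doubleS !exprS; field; rewrite gt_eqF.
rewrite ler_wpM2r ?exprn_ge0 ?(ltW a0)//.
have := @fact_le k.*2 k.+1.*2; rewrite leq_double leqnSn => /(_ isT).
lra.
Qed.

End AbsoluteMoments.

(** * Bounded polynomial approximation of the indicator of positive numbers on [-1, 1] *)

Section StepPolynomials.
Context {R : realType}.
Implicit Types (n : nat) (y : R).

(* The iterates of [y |-> (3 y - y^3) / 2] converge to the sign on [-1, 1]. *)
Fixpoint sgn_poly n : {poly R} :=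
  if n is n'.+1 then (3 / 2) *: sgn_poly n' - 2^-1 *: sgn_poly n' ^+ 3 else 'X.

(** The map [s |-> (s + s ^ 2) / 2] sends the signs -1, 0, 1 to 0, 0, 1. *)
Definition step_poly n : {poly R} := 2^-1 *: (sgn_poly n + sgn_poly n ^+ 2).

Lemma sgn_polyS n y : (sgn_poly n.+1).[y] =
  3 / 2 * (sgn_poly n).[y] - 2^-1 * (sgn_poly n).[y] ^+ 3.
Proof. by rewrite /= hornerD hornerN !hornerZ horner_exp. Qed.

Lemma sgn_polyN n y : (sgn_poly n).[- y] = - (sgn_poly n).[y].
Proof.
elim: n => [|n IH]; first by rewrite !hornerX.
by rewrite !sgn_polyS IH; ring.
Qed.

(** One iteration multiplies the distance [1 - z] by [1 - (z + z ^ 2) / 2]. Iterates stay above [y],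
    so this factor is at most [1 - y / 2] and the convergence is geometric. *)
Lemma sgn_poly_bound n y : 0 < y <= 1 ->
  y <= (sgn_poly n).[y] <= 1 /\ 1 - (sgn_poly n).[y] <= (1 - y / 2) ^+ n.
Proof.
move=> /andP[y0 y1]; elim: n => [|n [/andP[h1 h2] h3]].
  by rewrite hornerX expr0 lexx; split => //; lra.
rewrite sgn_polyS; move: (sgn_poly n).[y] h1 h2 h3 => z h1 h2 h3.
have z0 : 0 <= z by apply: le_trans h1; exact: ltW.
have e1 : 3 / 2 * z - 2^-1 * z ^+ 3 = z + z * (1 - z) * (1 + z) / 2 by field.
have e2 : 1 - (3 / 2 * z - 2^-1 * z ^+ 3) = (1 - z) * (1 - (z + z ^+ 2) / 2) by field.
have z2 : 0 <= z ^+ 2 <= 1 by rewrite exprn_ge0//= exprn_ile1.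
split.
  apply/andP; split.
    by rewrite e1 (le_trans h1)// lerDl divr_ge0// !mulr_ge0//; lra.
  by rewrite -subr_ge0 e2 mulr_ge0//; lra.
rewrite e2 (exprS _ n) mulrC ler_pM//; lra.
Qed.

Lemma step_poly_bound n y : `|y| <= 1 -> `|(step_poly n).[y]| <= 1.
Proof.
have b z : 0 < z <= 1 -> 0 <= (sgn_poly n).[z] <= 1.
  move=> z01; have [/andP[h1 ->] _] := sgn_poly_bound n z01.
  by rewrite andbT (le_trans _ h1)//; case/andP: z01 => /ltW.
have : `|y| <= 1 -> `|(sgn_poly n).[y]| <= 1.
  rewrite !ler_norml => /andP[y1 y2].
  have [y0|y0|<-] := ltgtP 0 y.
  - by have := b y; rewrite y0 y2 => /(_ isT); lra.
  - have := b (- y); rewrite sgn_polyN oppr_gt0 y0 lerNl y1 => /(_ isT).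
    by rewrite lerNl; lra.
  - have : (sgn_poly n).[0] = 0 :> R.
      by apply/eqP; have /eqP := sgn_polyN n 0; rewrite oppr0 -addr_eq0 -mulr2n mulrn_eq0.
    by move=> ->; lra.
move=> h /h {}h; rewrite /step_poly hornerZ hornerD horner_exp.
move: (sgn_poly n).[y] h => z z1.
rewrite normrM ger0_norm// ler_pdivrMl// mulr1 (le_trans (ler_normD _ _))//.
by rewrite -[leRHS]/(1 + 1) lerD// normrX exprn_ile1.
Qed.

Lemma cvg_step_poly y : `|y| <= 1 -> (step_poly n).[y] @[n --> \oo] --> ((0 < y)%R%:R : R).
Proof.
have c z : 0 < z <= 1 -> (sgn_poly n).[z] @[n --> \oo] --> (1 : R).
  move=> z01; have /andP[z0 z1] := z01.
  apply: (@squeeze_cvgr _ _ _ _ (fun n => 1 - (1 - z / 2) ^+ n) (fun=> 1)).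
  - apply: nearW => n; have [/andP[_ ->] h] := sgn_poly_bound n z01.
    by rewrite andbT; lra.
  - rewrite -[X in _ --> X](subr0 (1 : R)); apply: cvgB; first exact: cvg_cst.
    by apply: cvg_expr; rewrite ger0_norm; lra.
  - exact: cvg_cst.
have F (u : nat -> R) (l v : R) : u n @[n --> \oo] --> l -> (forall n, u n = (sgn_poly n).[y]) ->
    2^-1 * (l + l ^+ 2) = v -> (step_poly n).[y] @[n --> \oo] --> v.
  move=> ul uE <-; rewrite (_ : (fun n => _) = fun n => 2^-1 * (u n + u n * u n)).
    by apply: cvgM; [exact: cvg_cst|apply: cvgD => //; exact: cvgM].
  by apply/funext => n; rewrite /step_poly hornerZ hornerD horner_exp uE expr2.
rewrite ler_norml => /andP[y1 y2].
have [y0|y0|y0] := ltgtP 0 y.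
- apply: (F (fun n => (sgn_poly n).[y]) 1) => //=; last by field.
  by apply: c; rewrite y0.
- apply: (F (fun n => - (sgn_poly n).[- y]) (- 1)).
  + by apply: cvgN; apply: c; rewrite oppr_gt0 y0 lerNl.
  + by move=> n; rewrite sgn_polyN opprK.
  + by rewrite /=; field.
- apply: (F (fun=> 0) 0); first exact: cvg_cst.
  + move=> n; rewrite -y0; apply/eqP.
    by have /eqP := sgn_polyN n 0; rewrite oppr0 -addr_eq0 -mulr2n mulrn_eq0/= eq_sym.
  + by rewrite /=; field.
Qed.

End StepPolynomials.

(** * Moments of factorial growth determine the distribution *)

Section MomentDeterminacy.
Context {d1 d2} {T1 : measurableType d1} {T2 : measurableType d2} {R : realType}.
Variables (m1 : {measure set T1 -> \bar R}) (m2 : {measure set T2 -> \bar R}).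
Variables (X1 w1 : T1 -> R) (X2 w2 : T2 -> R).
Hypotheses (mX1 : measurable_fun [set: T1] X1) (mw1 : measurable_fun [set: T1] w1).
Hypotheses (mX2 : measurable_fun [set: T2] X2) (mw2 : measurable_fun [set: T2] w2).
Hypotheses (w10 : forall x, 0 <= w1 x) (w20 : forall x, 0 <= w2 x).
Local Notation W1 := (wintegrable m1 X1 w1).
Local Notation W2 := (wintegrable m2 X2 w2).
Local Notation J1 := (wint m1 X1 w1).
Local Notation J2 := (wint m2 X2 w2).
Implicit Types (h g : R -> R).

(** Measurability and integrability on both sides travel with the equality, so that sums, multiples
    and limits can be chained. *)
Definition weq h := [/\ measurable_fun [set: R] h, W1 h, W2 h & J1 h = J2 h].

Lemma weqD h g : weq h -> weq g -> weq (fun x => h x + g x).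
Proof.
move=> [mh ih1 ih2 eh] [mg ig1 ig2 eg]; split.
- exact: measurable_funD.
- exact: wintegrableD.
- exact: wintegrableD.
- by rewrite !wintD// eh eg.
Qed.

Lemma weqZ (c : R) h : weq h -> weq (fun x => c * h x).
Proof.
move=> [mh ih1 ih2 eh]; split.
- exact: measurable_funM.
- exact: wintegrableZ.
- exact: wintegrableZ.
- by rewrite !wintZ// eh.
Qed.

Lemma weqB h g : weq h -> weq g -> weq (fun x => h x - g x).
Proof.
move=> wh /(weqZ (-1)) wg; have := weqD wh wg.
by under eq_fun do rewrite mulN1r.
Qed.

Lemma weq_sum n (F : 'I_n -> R -> R) : (forall i, weq (F i)) ->
  weq (fun x => \sum_(i < n) F i x).
Proof.
elim: n F => [|n IH] F h.
  under eq_fun do rewrite big_ord0.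
  by split => //; [exact: wintegrable0|exact: wintegrable0|rewrite !wint0].
by under eq_fun do rewrite big_ord_recl; apply: weqD => //; exact: IH.
Qed.

Lemma weq_dominated (h_ : nat -> R -> R) h (B : R) : weq (fun=> 1) ->
  (forall n, weq (h_ n)) -> (forall n x, `|h_ n x| <= B) ->
  (forall x, h_ n x @[n --> \oo] --> h x) -> weq h.
Proof.
move=> [_ i1 i2 _] wh hB hh.
have mh_ n : measurable_fun [set: R] (h_ n) by have [] := wh n.
have mh : measurable_fun [set: R] h by apply: measurable_fun_cvg mh_ _ => x _; exact: hh.
have B1 n x : `|h_ n x| <= B * 1 by rewrite mulr1.
have [ih1 c1] := wint_dominated mX1 mw1 w10 mh_ mh hh B1 (wintegrableZ B i1).
have [ih2 c2] := wint_dominated mX2 mw2 w20 mh_ mh hh B1 (wintegrableZ B i2).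
split => //; apply: (cvg_unique _ c1) => //.
apply: cvg_trans c2; apply: near_eq_cvg; apply: nearW => n.
by have [] := wh n.
Qed.

(** For approximations that are not uniformly bounded: the error is controlled in mean on both
    sides, and [|J1 h - J2 h|] is at most twice the bound. *)
Lemma weq_approx (h_ g_ : nat -> R -> R) h (e : nat -> R) :
  measurable_fun [set: R] h -> W1 h -> W2 h ->
  (forall n, weq (h_ n)) -> (forall n x, `|h x - h_ n x| <= g_ n x) ->
  (forall n, W1 (g_ n)) -> (forall n, W2 (g_ n)) ->
  (forall n, J1 (g_ n) <= e n) -> (forall n, J2 (g_ n) <= e n) ->
  e n @[n --> \oo] --> (0 : R) -> weq h.
Proof.
move=> mh ih1 ih2 wh hg ig1 ig2 e1 e2 ecvg; split => //.
apply/eqP; rewrite -subr_eq0 -normr_eq0 eq_le normr_ge0 andbT.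
have e2cvg : e n + e n @[n --> \oo] --> (0 : R).
  by rewrite -[X in _ --> X](addr0 (0 : R)); exact: cvgD.
apply: (cvgr_to_ge e2cvg); apply: nearW => n.
have [_ ihn1 ihn2 En] := wh n.
have -> : J1 h - J2 h = J1 (fun x => h x - h_ n x) - J2 (fun x => h x - h_ n x).
  by rewrite !wintB// En; ring.
rewrite (le_trans (ler_normB _ _))// lerD//.
  by rewrite (le_trans _ (e1 n))// wint_norm_le//; exact: wintegrableB.
by rewrite (le_trans _ (e2 n))// wint_norm_le//; exact: wintegrableB.
Qed.

Variable a : R.
Hypothesis a0 : 0 < a.
Hypothesis weq_pow : forall j, weq (fun x => x ^+ j).
Hypothesis moment_le : forall k, J1 (fun x => x ^+ k.*2) <= (k.*2)`!%:R * a ^+ k.*2.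

Let ipow1 j : W1 (fun x => x ^+ j). Proof. by have [] := weq_pow j. Qed.
Let ipow2 j : W2 (fun x => x ^+ j). Proof. by have [] := weq_pow j. Qed.

Let abs_moment1 j : J1 (fun x => `|x| ^+ j) <= (j.+1)`!%:R * a ^+ j.
Proof. exact: abs_moment_le. Qed.

Let abs_moment2 j : J2 (fun x => `|x| ^+ j) <= (j.+1)`!%:R * a ^+ j.
Proof.
apply: abs_moment_le => // k.
by have [_ _ _ <-] := weq_pow k.*2; exact: moment_le.
Qed.

Let bin_le k p : ('C(k, p) <= 2 ^ k)%N.
Proof.
elim: k p => [|k IH] [|p] //; first by rewrite bin0 expn_gt0.
by rewrite binS expnS mul2n -addnn leq_add.
Qed.

(** The left side is a binomial coefficient [C(j + M + 1, M)] times [(j + 1)!]. *)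
Let fact_ratio_le j M : ((j + M).+1)`!%:R / M`!%:R <= (j.+1)`!%:R * 2 ^+ (j + M).+1 :> R.
Proof.
rewrite ler_pdivrMr ?ltr0n ?fact_gt0//.
have jM : (M <= (j + M).+1)%N by rewrite -addSn leq_addl.
rewrite -(bin_fact jM) -addSn addnK -natrX -!natrM ler_nat.
by rewrite mulnC [leqRHS]mulnAC (mulnC M`!) leq_mul2l bin_le orbT.
Qed.

(** The factorial ratio grows like [2 ^ M], and [|s| * a <= 1/4] contributes [4 ^ (-M)], which
    leaves the geometric factor [2 ^ (-M)]. *)
Let remainder_le (s : R) j M : `|s| * a <= 4%:R^-1 ->
  `|s| ^+ M / M`!%:R * ((j + M).+1%N`!%:R * a ^+ (j + M)) <=
  (j.+1)`!%:R * 2 ^+ j.+1 * a ^+ j * 2^-1 ^+ M.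
Proof.
move=> sa; have eqle (x y : R) : x = y -> x <= y by move=> ->.
apply: (@le_trans _ _ (((j + M).+1)`!%:R / M`!%:R * (a ^+ j * (`|s| * a) ^+ M))).
  by rewrite exprMn exprD; apply: eqle; ring.
apply: (@le_trans _ _ ((j.+1)`!%:R * 2 ^+ (j + M).+1 * (a ^+ j * 4%:R^-1 ^+ M))).
  apply: ler_pM => //.
  - by rewrite mulr_ge0 ?exprn_ge0 ?mulr_ge0 ?(ltW a0).
  - rewrite ler_wpM2l ?exprn_ge0 ?(ltW a0)// lerXn2r ?nnegrE ?mulr_ge0 ?(ltW a0)//.
apply: eqle.
have -> : 4^-1 = 2^-1 * 2^-1 :> R by rewrite -invfM -natrM.
rewrite -addSn exprD exprMn.
have e : 2 ^+ M * 2^-1 ^+ M = 1 :> R by rewrite -exprMn mulfV ?expr1n.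
rewrite [LHS](_ : _ = (j.+1)`!%:R * 2 ^+ j.+1 * a ^+ j * 2^-1 ^+ M * (2 ^+ M * 2^-1 ^+ M)).
  by rewrite e mulr1.
ring.
Qed.

(** Replacing [cos (s * x)] and [sin (s * x)] by Taylor polynomials leaves combinations of
    [x ^ p * f1 x] and [x ^ p * f2 x], covered by the hypotheses. The admissible size of [s] depends
    on [a] only, so such steps can be iterated. *)
Let weq_trig_step (f1 f2 : R -> R) (s : R) :
  (forall x, `|f1 x| <= 1) -> (forall x, `|f2 x| <= 1) -> `|s| * a <= 4%:R^-1 ->
  (forall j, weq (fun x => x ^+ j * f1 x)) -> (forall j, weq (fun x => x ^+ j * f2 x)) ->
  forall j, weq (fun x => x ^+ j * (f1 x * cos (s * x) + f2 x * sin (s * x))).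
Proof.
move=> f1_1 f2_1 sa wf1 wf2 j.
pose h_ N (x : R) := x ^+ j * (f1 x * cosT N (s * x) + f2 x * sinT N (s * x)).
pose g_ N (x : R) := `|s| ^+ N.*2 / (N.*2)`!%:R * `|x| ^+ (j + N.*2) +
  `|s| ^+ N.*2.+1 / (N.*2.+1)`!%:R * `|x| ^+ (j + N.*2.+1).
pose K : R := (j.+1)`!%:R * 2 ^+ j.+1 * a ^+ j.
have mf (f : R -> R) : weq (fun x => x ^+ 0 * f x) -> measurable_fun [set: R] f.
  by case=> + _ _ _; under eq_fun do rewrite expr0 mul1r.
have mh : measurable_fun [set: R] (fun x => x ^+ j * (f1 x * cos (s * x) + f2 x * sin (s * x))).
  apply: measurable_funM; first exact: exprn_measurable.
  apply: measurable_funD; apply: measurable_funM; try exact: mf.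
    exact: measurable_cosM.
  exact: measurable_sinM.
have hle (x : R) : `|x ^+ j * (f1 x * cos (s * x) + f2 x * sin (s * x))| <= 2 * `|x| ^+ j.
  rewrite normrM normrX mulrC ler_wpM2r ?exprn_ge0//.
  rewrite (le_trans (ler_normD _ _))// !normrM -[leRHS]/(1 + 1) lerD//.
    by rewrite mulr_ile1 ?f1_1 ?cos_max.
  by rewrite mulr_ile1 ?f2_1 ?sin_max.
(* The terms at [M = 2 N] and [M = 2 N + 1] contribute [1] and [1/2] times [K * 4 ^ (-N)], whence
   the constant [3/2]. *)
have bound N (B : nat -> R) : (forall i, B i <= (i.+1)`!%:R * a ^+ i) ->
    `|s| ^+ N.*2 / (N.*2)`!%:R * B (j + N.*2)%N +
    `|s| ^+ N.*2.+1 / (N.*2.+1)`!%:R * B (j + N.*2.+1)%N <= K * (3 / 2) * 4^-1 ^+ N.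
  move=> hB.
  have hM M : `|s| ^+ M / M`!%:R * B (j + M)%N <= K * 2^-1 ^+ M.
    by apply: le_trans (remainder_le j M sa); rewrite ler_wpM2l// divr_ge0// exprn_ge0.
  apply: (le_trans (lerD (hM _) (hM _))).
  have -> : 4^-1 ^+ N = 2^-1 ^+ N.*2 :> R 
    by rewrite -mul2n exprM (exprVn 2 2) -natrX.
  rewrite exprS; move: (2^-1 ^+ N.*2) => z; lra.
apply: (@weq_approx h_ g_ _ (fun N => K * (3 / 2) * 4^-1 ^+ N)) => //.
- by apply: (wintegrable_le mX1 mw1 mh hle); apply: wintegrableZ; exact: wintegrable_normX.
- by apply: (wintegrable_le mX2 mw2 mh hle); apply: wintegrableZ; exact: wintegrable_normX.
- move=> N.
  rewrite (_ : h_ N = fun x =>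
    \sum_(i < N) ((-1) ^+ i * s ^+ i.*2 / (i.*2)`!%:R) * (x ^+ (j + i.*2) * f1 x) +
    \sum_(i < N) ((-1) ^+ i * s ^+ i.*2.+1 / (i.*2.+1)`!%:R) * (x ^+ (j + i.*2.+1) * f2 x)).
    by apply: weqD; apply: weq_sum => i; exact: weqZ.
  apply/funext => x; rewrite /h_ mulrDr /cosT /sinT !mulr_sumr.
  by congr (_ + _); apply: eq_bigr => i _; rewrite exprMn exprD; ring.
- move=> N x; rewrite /h_ -mulrBr normrM normrX.
  rewrite (_ : _ - _ = f1 x * (cos (s * x) - cosT N (s * x)) +
                       f2 x * (sin (s * x) - sinT N (s * x))); last by ring.
  rewrite /g_ !exprD !mulrA ![_ * `|x| ^+ j]mulrC -!mulrA -mulrDr ler_wpM2l ?exprn_ge0//.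
  rewrite (le_trans (ler_normD _ _))// !normrM lerD//.
    rewrite (le_trans (ler_wpM2r _ (f1_1 _)))// mul1r (le_trans (cos_taylor_bound _ _))//.
    rewrite mulrCA mulrC ler_wpM2l ?invr_ge0// -!normrX -normrM -exprMn.
    exact: ler_norm.
  rewrite (le_trans (ler_wpM2r _ (f2_1 _)))// mul1r (le_trans (sin_taylor_bound _ _))//.
  by rewrite mulrCA mulrC ler_wpM2l ?invr_ge0// normrM exprMn.
- by move=> N; apply: wintegrableD; apply: wintegrableZ; exact: wintegrable_normX.
- by move=> N; apply: wintegrableD; apply: wintegrableZ; exact: wintegrable_normX.
- move=> N; rewrite wintD ?wintZ//; try exact: wintegrable_normX;
    try by apply: wintegrableZ; exact: wintegrable_normX.
  exact: (bound N (fun i => J1 (fun x => `|x| ^+ i))).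
- move=> N; rewrite wintD ?wintZ//; try exact: wintegrable_normX;
    try by apply: wintegrableZ; exact: wintegrable_normX.
  exact: (bound N (fun i => J2 (fun x => `|x| ^+ i))).
- have := @cvg_geometric R (K * (3 / 2)) 4^-1; apply.
  by rewrite ger0_norm// invf_lt1// ltr1n.
Qed.

(** Starting from [t = 0], where the claim is the equality of moments, [t] is reached in [N + 1]
    equal steps short enough for [weq_trig_step]. *)
Lemma weq_trig (t : R) :
  (forall j, weq (fun x => x ^+ j * cos (t * x))) /\
  (forall j, weq (fun x => x ^+ j * sin (t * x))).
Proof.
have step (u s : R) : `|s| * a <= 4%:R^-1 ->
    (forall j, weq (fun x => x ^+ j * cos (u * x))) /\
    (forall j, weq (fun x => x ^+ j * sin (u * x))) ->
    (forall j, weq (fun x => x ^+ j * cos ((u + s) * x))) /\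
    (forall j, weq (fun x => x ^+ j * sin ((u + s) * x))).
  move=> sa [wc ws]; split => j.
    have := @weq_trig_step (fun x => cos (u * x)) (fun x => - sin (u * x)) s.
    under eq_fun => x do rewrite mulrDl cosD -mulNr.
    apply => //; first by move=> x; exact: cos_max.
    - by move=> x; rewrite normrN sin_max.
    - by move=> p; have := weqZ (-1) (ws p); under eq_fun do rewrite mulN1r -mulrN.
  have := @weq_trig_step (fun x => sin (u * x)) (fun x => cos (u * x)) s.
  under eq_fun => x do rewrite mulrDl sinD.
  by apply => // x; [exact: sin_max|exact: cos_max].
pose N := Num.bound (`|t| * a * 4).
have tN : `|t| * a * 4 <= N.+1%:R.
  have := archi_boundP (_ : 0 <= `|t| * a * 4); rewrite !mulr_ge0 ?(ltW a0)// => /(_ isT).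
  by move=> /ltW/le_trans; apply; rewrite ler_nat.
have sN : `|t / N.+1%:R| * a <= 4^-1.
  by rewrite normrM normfV normr_nat mulrAC ler_pdivrMr// ler_pdivlMl// mulrC.
have -> : t = N.+1%:R * (t / N.+1%:R) by rewrite mulrC divfK.
move: (t / N.+1%:R) sN => s sN.
elim: N.+1 => [|n IH].
  split=> j.
    by under eq_fun do rewrite !mul0r cos0 mulr1; exact: weq_pow.
  under eq_fun do rewrite !mul0r sin0 mulr0.
  by have := weqZ 0 (weq_pow 0); under eq_fun do rewrite mul0r.
by rewrite -natr1 mulrDl mul1r; exact: step.
Qed.

Let weq1 : weq (fun=> 1).
Proof. by have := weq_pow 0; under eq_fun do rewrite expr0. Qed.

(* Unlike [weq] itself, this class is stable under products with [sin] and [cos]. *)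
Let trig_mul (h : R -> R) := forall t : R,
  weq (fun x => h x * cos (t * x)) /\ weq (fun x => h x * sin (t * x)).

Let trig_mulD h g : trig_mul h -> trig_mul g -> trig_mul (fun x => h x + g x).
Proof.
move=> hh hg t; have [h1 h2] := hh t; have [g1 g2] := hg t.
by split; under eq_fun do rewrite mulrDl; exact: weqD.
Qed.

Let trig_mulZ (c : R) h : trig_mul h -> trig_mul (fun x => c * h x).
Proof.
move=> hh t; have [h1 h2] := hh t.
by split; under eq_fun do rewrite -mulrA; exact: weqZ.
Qed.

(** Product-to-sum formulas move the product to the frequencies [t + s] and [t - s]. *)
Let trig_mulM (s : R) h : trig_mul h ->
  trig_mul (fun x => h x * cos (s * x)) /\ trig_mul (fun x => h x * sin (s * x)).
Proof.
move=> hh.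
have F f g f' : weq f -> weq g -> f' =1 (fun x => 2^-1 * (f x + g x)) -> weq f'.
  by move=> wf wg /funext ->; apply: weqZ; exact: weqD.
have F' f g f' : weq f -> weq g -> f' =1 (fun x => 2^-1 * (f x - g x)) -> weq f'.
  by move=> wf wg /funext ->; apply: weqZ; exact: weqB.
split=> t; have [c1 s1] := hh (t + s); have [c2 s2] := hh (t - s); split.
- by apply: (F _ _ _ c1 c2) => x; rewrite mulrDl mulrBl cosD cosB; field.
- by apply: (F _ _ _ s1 s2) => x; rewrite mulrDl mulrBl sinD sinB; field.
- by apply: (F' _ _ _ s1 s2) => x; rewrite mulrDl mulrBl sinD sinB; field.
- by apply: (F' _ _ _ c2 c1) => x; rewrite mulrBl mulrDl cosB cosD; field.
Qed.

(** The addition formula writes [sin (s * (x - b))] through [sin (s * x)] and [cos (s * x)], so in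
    Horner form each multiplication by the variable stays inside [trig_mul]. Frequency [t = 0] gives
    the claim. *)
Lemma weq_poly_sin (s b : R) (p : {poly R}) : weq (fun x => p.[sin (s * (x - b))]).
Proof.
have tp : trig_mul (fun x => p.[sin (s * (x - b))]).
  have t1 (c : R) : trig_mul (fun=> c).
    move=> t; have [c1 s1] := weq_trig t; split; apply: weqZ.
      by have := c1 0; under eq_fun do rewrite expr0 mul1r.
    by have := s1 0; under eq_fun do rewrite expr0 mul1r.
  elim/poly_ind: p => [|p c IH]; first by under eq_fun do rewrite horner0; exact: t1.
  rewrite (_ : (fun x => _) = fun x =>
     cos (s * b) * (p.[sin (s * (x - b))] * sin (s * x)) +
     (- sin (s * b)) * (p.[sin (s * (x - b))] * cos (s * x)) + c).
    apply: trig_mulD => //; apply: trig_mulD; apply: trig_mulZ.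
      by have [] := trig_mulM s IH.
    by have [] := trig_mulM s IH.
  apply/funext => x; rewrite hornerMXaddC mulrBr sinB; ring.
have [+ _] := tp 0.
by under eq_fun do rewrite mul0r cos0 mulr1.
Qed.

Let weq_sin_gt0 (s b : R) : weq (fun x => (0 < sin (s * (x - b)))%R%:R).
Proof.
apply: (@weq_dominated (fun n x => (step_poly n).[sin (s * (x - b))]) _ 1) => //.
- by move=> n; exact: weq_poly_sin.
- by move=> n x; exact/step_poly_bound/sin_max.
- by move=> x; exact/cvg_step_poly/sin_max.
Qed.

Lemma weq_gt (b : R) : weq (fun x => (b < x)%R%:R).
Proof.
apply: (@weq_dominated (fun n x => (0 < sin (n.+1%:R^-1 * (x - b)))%R%:R) _ 1) => //.
- by move=> n x; case: ltP => _; rewrite ?normr1 ?normr0.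
move=> x; apply: cvg_near_cst.
have : n.+1%:R^-1 * (x - b) @[n --> \oo] --> (0 : R).
  rewrite -[X in _ --> X](mul0r (x - b)); apply: cvgM; last exact: cvg_cst.
  exact: cvg_harmonic.
(* For arguments in ]-2, 2[ the sine has the sign of its argument, so for each [x] the sequence of
   indicators is eventually constant. *)
move=> /cvgrPdist_lt/(_ 2 (ltr0n _ 2)); apply: filterS => n.
rewrite sub0r normrN ltr_norml => /andP[h1 h2].
have n0 : 0 < n.+1%:R^-1 :> R by rewrite invr_gt0.
have [bx|xb] := ltP b x.
  by rewrite sin2_gt0// h2 mulr_gt0// subr_gt0.
rewrite ltNge (_ : _ <= 0)//.
have [->|xb'] := eqVneq x b; first by rewrite subrr mulr0 sin0.
rewrite -oppr_ge0 -sinN ltW// sin2_gt0// ltrNl h1 andbT oppr_gt0.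
by rewrite pmulr_rlt0// subr_lt0 lt_neqAle xb'.
Qed.

End MomentDeterminacy.

(** * Moments of the Laplace density *)

Section LaplaceMoments.
Context {R : realType} (l : R).
Hypothesis l0 : 0 < l.

Definition laplace_pdf (y : R) : R := l / 2 * expR (- (l * `|y|)).

Lemma laplace_pdf_ge0 y : 0 <= laplace_pdf y.
Proof. by rewrite /laplace_pdf mulr_ge0 ?expR_ge0// divr_ge0// ltW. Qed.

Lemma continuous_expRN_abs : continuous (fun y : R => expR (- (l * `|y|))).
Proof.
move=> y; apply: (@cvg_comp _ _ _ (fun y => - (l * `|y|)) expR); last exact: continuous_expR.
apply: cvgN; apply: cvgM; first exact: cvg_cst.
exact: norm_continuous.
Qed.

Lemma continuous_laplace_pdf : continuous laplace_pdf.
Proof.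
by move=> y; apply: cvgM; [exact: cvg_cst|exact: continuous_expRN_abs].
Qed.

(** The primitive of [l * y ^ k * exp (- l * y)] that vanishes at infinity, unfolded by one
    integration by parts per power of [y]. *)
Fixpoint gamma_prim k (y : R) : R :=
  if k is k'.+1 then - (y ^+ k * expR (- (l * y))) + k%:R / l * gamma_prim k' y
  else - expR (- (l * y)).

Let is_derive_expRN (y : R) :
  is_derive y 1 (fun y => expR (- (l * y))) (- l * expR (- (l * y))).
Proof.
have h : is_derive y 1 (fun y : R => - (l * y)) (- l).
  by apply: trigger_derive; rewrite /GRing.scale/= mulr1.
have := @is_derive1_comp _ expR (fun y : R => - (l * y)) y _ _ (is_derive_expR _) h.
by rewrite mulrC.
Qed.

Lemma is_derive_gamma_prim k (y : R) :
  is_derive y 1 (gamma_prim k) (l * (y ^+ k * expR (- (l * y)))).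
Proof.
elim: k => [|k IH].
  have := is_deriveN (is_derive_expRN y).
  by rewrite expr0 mul1r mulNr opprK.
have hX : is_derive y 1 (fun y : R => y ^+ k.+1) (k.+1%:R * y ^+ k).
  have := is_derive_poly 'X^(k.+1) y; rewrite derivXn hornerMn hornerXn/= -mulr_natl.
  by rewrite (_ : horner 'X^(k.+1) = (fun y => y ^+ k.+1))//; apply/funext => z; rewrite hornerXn.
have hM := is_deriveM hX (is_derive_expRN y).
have := is_deriveD (is_deriveN hM) (is_deriveZ (k.+1%:R / l) IH).
rewrite /GRing.scale/= => h.
apply: (@is_derive_eq _ _ _ _ _ _ _ _ h).
by rewrite exprS; field; rewrite gt_eqF.
Qed.

Lemma gamma_prim0 k : gamma_prim k 0 = - (k`!%:R / l ^+ k).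
Proof.
elim: k => [|k IH] /=; first by rewrite mulr0 oppr0 expR0 fact0 expr0 divr1.
rewrite expr0n/= mul0r oppr0 add0r IH factS natrM exprS.
by rewrite invfM mulrN mulrACA [X in _ * X]mulrC mulrA.
Qed.

Lemma cvgy_gamma_prim k : gamma_prim k y @[y --> +oo] --> (0 : R).
Proof.
have c j : y ^+ j * expR (- (l * y)) @[y --> +oo] --> (0 : R).
  (* Bounding the exponential below by its Taylor term of order [j + 1], one above the power
     [y ^ j], leaves a factor [1 / y]. *)
  apply: (@squeeze_cvgr _ _ _ _ (fun=> 0) (fun y => (j.+1)`!%:R / l ^+ j.+1 * y^-1)).
  - near=> y.
    have y0 : 0 < y by near: y; exact: nbhs_pinfty_gt.
    rewrite mulr_ge0 ?exprn_ge0 ?(ltW y0) ?expR_ge0//=.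
    have := expR_ge1Dxn j (_ : 0 <= l * y); rewrite mulr_ge0 ?(ltW l0) ?(ltW y0)// => /(_ isT) h.
    rewrite expRN ler_pdivrMr ?expR_gt0//.
    have -> : y ^+ j = (j.+1)`!%:R / l ^+ j.+1 / y * ((l * y) ^+ j.+1 / (j.+1)`!%:R).
      rewrite exprMn [y ^+ _.+1]exprS; field.
      by rewrite pnatr_eq0 -lt0n fact_gt0 (gt_eqF y0) gt_eqF// exprn_gt0.
    rewrite ler_wpM2l//; last by apply: le_trans h; rewrite lerDr.
    by rewrite !mulr_ge0 ?invr_ge0 ?exprn_ge0 ?(ltW l0) ?(ltW y0).
  - exact: cvg_cst.
  - rewrite -[X in _ --> X](mulr0 ((j.+1)`!%:R / l ^+ j.+1)); apply: cvgM; first exact: cvg_cst.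
    by apply/gtr0_cvgV0; [exact: nbhs_pinfty_gt|exact: cvg_id].
elim: k => [|k IH] /=.
  have := c 0; under eq_fun do rewrite expr0 mul1r.
  by move=> /cvgN; rewrite oppr0.
rewrite -[X in _ --> X](addr0 (0 : R)); apply: cvgD.
  by rewrite -[X in _ --> X]oppr0; apply: cvgN; exact: c.
rewrite -[X in _ --> X](mulr0 (k.+1%:R / l)); apply: cvgM => //; exact: cvg_cst.
Unshelve. all: by end_near. Qed.

Lemma integral_gamma k :
  (\int[lebesgue_measure]_(y in `[0%R, +oo[) (l * (y ^+ k * expR (- (l * y))))%:E =
   (k`!%:R / l ^+ k)%:E)%E.
Proof.
have ce : continuous (fun y : R => expR (- (l * y))).
  exact: is_derive_continuous is_derive_expRN.
rewrite (@ge0_continuous_FTC2y _ _ (gamma_prim k) 0 0).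
- by rewrite gamma_prim0 sub0e EFinN oppeK.
- by move=> x x0; rewrite !mulr_ge0 ?exprn_ge0 ?expR_ge0// ltW.
- apply: continuous_subspaceT => y; apply: cvgM; first exact: cvg_cst.
  by apply: cvgM; [exact: exprn_continuous|exact: ce].
- exact: cvgy_gamma_prim.
- by move=> x _; have := is_derive_gamma_prim k x => h; exact: ex_derive.
- by apply: cvg_at_right_filter; exact: (is_derive_continuous (is_derive_gamma_prim k)).
- by move=> x _; rewrite derive1E (@derive_val _ _ _ _ _ _ _ (is_derive_gamma_prim k x)).
Qed.

Local Notation mu := lebesgue_measure.
Let X : measurableTypeR R -> R := fun y => y.

Lemma measurable_idR : measurable_fun [set: measurableTypeR R] X.
Proof. exact: measurable_id. Qed.

Lemma measurable_laplace_pdf : measurable_fun [set: measurableTypeR R] laplace_pdf.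
Proof. by apply: continuous_measurable_fun; exact: continuous_laplace_pdf. Qed.

(** By symmetry the integral is twice the one over the half-line, which absorbs the [1/2] of the
    density and leaves [integral_gamma]. *)
Lemma integral_abs_laplace k :
  (\int[mu]_y (`|y| ^+ k * laplace_pdf y)%:E = (k`!%:R / l ^+ k)%:E)%E.
Proof.
have cf : continuous (fun y : R => `|y| ^+ k * laplace_pdf y).
  have cn : continuous (fun y : R => `|y| ^+ k).
    elim: k => [|p IH] y; first by under eq_fun do rewrite expr0; exact: cvg_cst.
    by under eq_fun do rewrite exprS; apply: cvgM; [exact: norm_continuous|exact: IH].
  by move=> y; apply: cvgM; [exact: cn|exact: continuous_laplace_pdf].
rewrite ge0_symfun_integralT//; last 2 first.
- by move=> x; rewrite mulr_ge0 ?exprn_ge0 ?laplace_pdf_ge0.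
- by move=> x; rewrite /= /laplace_pdf normrN.
rewrite -set_itvcy -ge0_integralZl_EFin//; last 2 first.
- by move=> x _; rewrite lee_fin mulr_ge0 ?exprn_ge0 ?laplace_pdf_ge0.
- apply/measurable_EFinP; apply: measurable_funTS.
  by apply: continuous_measurable_fun.
rewrite -integral_gamma; apply: eq_integral => y; rewrite inE/= in_itv/= andbT => y0.
by rewrite -EFinM /laplace_pdf ger0_norm//; congr EFin; field.
Qed.

Lemma wintegrable_abs_laplace k : wintegrable mu X laplace_pdf (fun x => `|x| ^+ k).
Proof.
apply/integrableP; split.
  apply: (measurable_wfun measurable_idR measurable_laplace_pdf (h := fun x => `|x| ^+ k)).
  by apply: measurable_funX; exact: normr_measurable.
rewrite (_ : (\int[mu]_x _ = (k`!%:R / l ^+ k)%:E)%E) ?ltry// -integral_abs_laplace.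
apply: eq_integral => x _; rewrite gee0_abs// lee_fin.
by rewrite mulr_ge0 ?exprn_ge0 ?laplace_pdf_ge0.
Qed.

Lemma wintegrable_pow_laplace k : wintegrable mu X laplace_pdf (fun x => x ^+ k).
Proof.
apply: (wintegrable_le measurable_idR measurable_laplace_pdf _ _ (wintegrable_abs_laplace k)).
  exact: exprn_measurable.
by move=> x; rewrite normrX.
Qed.

Lemma laplace_moment_even k :
  wint mu X laplace_pdf (fun x => x ^+ k.*2) = (k.*2)`!%:R / l ^+ k.*2.
Proof.
rewrite /wint /Rintegral -[RHS]/(fine ((k.*2)`!%:R / l ^+ k.*2)%:E) -integral_abs_laplace.
congr fine; apply: eq_integral => x _; congr (_ * _)%:E.
by rewrite -normrX ger0_norm// -mul2n exprM exprn_ge0// sqr_ge0.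
Qed.

(** Lebesgue measure is invariant under [y |-> - y] and the integrand is odd, so the integral equals
    its own opposite; being finite, it is 0. *)
Lemma laplace_moment_odd k : wint mu X laplace_pdf (fun x => x ^+ k.*2.+1) = 0.
Proof.
pose phi : measurableTypeR R -> measurableTypeR R := -%R.
have mphi : measurable_fun [set: measurableTypeR R] phi by exact: oppr_measurable.
pose f (y : measurableTypeR R) : \bar R := (X y ^+ k.*2.+1 * laplace_pdf y)%:E.
have mf : measurable_fun [set: measurableTypeR R] f.
  apply: (measurable_wfun measurable_idR measurable_laplace_pdf (h := fun x => x ^+ k.*2.+1)).
  exact: exprn_measurable.
have fN : f \o phi = (fun y => - f y)%E.
  apply/funext => y.
  change (((- (y : R)) ^+ k.*2.+1 * laplace_pdf (- (y : R)))%:E =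
          (- ((y : R) ^+ k.*2.+1 * laplace_pdf y))%:E); congr EFin.
  rewrite /laplace_pdf normrN (exprNn y) -signr_odd oddS odd_double expr1; ring.
have i_f := wintegrable_pow_laplace k.*2.+1.
have h := @integral_pushforward _ _ _ _ _ phi mphi mu setT f mf _ measurableT.
have E : (\int[pushforward mu phi]_y f y = \int[mu]_y f y)%E.
  by apply: eq_measure_integral => //= A mA _; exact: lebesgue_measureN.
have {}h : (\int[mu]_y f y = - \int[mu]_y f y)%E.
  rewrite -[LHS]E h preimage_setT fN ?integralN//.
    exact: integrable_add_def.
  exact: integrableN.
have F : (\int[mu]_y f y)%E \is a fin_num by exact: integrable_fin_num.
rewrite /wint /Rintegral -/f; move: h; rewrite -/(f _).
rewrite -(fineK F) -EFinN => -[/eqP]; rewrite -subr_eq0 opprK -mulr2n mulrn_eq0/= => /eqP.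
by [].
Qed.

End LaplaceMoments.

(** * Expectations of a random variable as integrals of weight 1 *)

Section CharfunMoments.
Context {d} {T : measurableType d} {R : realType} (P : probability T R) (X : {RV P >-> R}).
Local Notation W1 := (fun=> 1 : R).
Local Notation WI := (wintegrable P X W1).
Local Notation J := (wint P X W1).

Let mX : measurable_fun [set: T] X. Proof. exact: measurable_funP. Qed.
Let mw : measurable_fun [set: T] (W1 : T -> R). Proof. exact: measurable_cst. Qed.
Let w0 (x : T) : 0 <= (W1 : T -> R) x. Proof. exact: ler01. Qed.

Lemma charfunE t : charfun X t =
  (J (fun x => cos (t * x)) +i* J (fun x => sin (t * x)))%C.
Proof.
rewrite /charfun unlock /wint /Rintegral.
by congr (fine _ +i* fine _)%C; apply: eq_integral => x _; rewrite mulr1.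
Qed.

Lemma wintegrable_RV_cst : WI (fun=> 1).
Proof.
apply: (@eq_integrable _ _ _ P setT _ (cst 1%:E)) => //; last exact: finite_measure_integrable_cst.
by move=> x _; rewrite /= mulr1.
Qed.

Lemma wint_RV_cst : J (fun=> 1) = 1.
Proof.
rewrite /wint /Rintegral (eq_integral (cst 1%:E)); last by move=> x _; rewrite mulr1.
by rewrite integral_cst//= (@probability_setT _ _ _ P) mule1.
Qed.

Lemma wint_RV_gt b : (J (fun x => (b < x)%R%:R))%:E = P [set w | b < X w].
Proof.
have mA : measurable [set w | b < X w].
  rewrite -[X in measurable X]setTI; have := mX measurableT (measurable_itv `]b, +oo[).
  by congr measurable; apply/seteqP; split => x /=; rewrite in_itv/= andbT.
have <- : (\int[P]_x (\1_[set w | (b < X w)%R] x)%:E)%E = P [set w | b < X w].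
  by rewrite integral_indic// setIT.
rewrite /wint /Rintegral fineK.
  apply: eq_integral => x _; rewrite mulr1 indicE; congr (_%:R)%:E.
  by congr nat_of_bool; apply/idP/idP => [?|]; [exact/mem_set|rewrite inE].
apply: integrable_fin_num => //.
have := @wintegrable_le _ _ _ P X W1 mX mw (fun x => (b < x)%R%:R) (fun=> 1) _ _ wintegrable_RV_cst.
apply.
- rewrite (_ : (fun x => _) = \1_`]b, +oo[); first exact: measurable_indic.
  by apply/funext => x; rewrite indicE mem_setE in_itv/= andbT.
- by move=> x; case: ltP => _; rewrite ?normr1 ?normr0.
Qed.

Lemma RV_eq0 : WI (fun x => x ^+ 2) -> J (fun x => x ^+ 2) = 0 -> P [set w | X w = 0] = 1%E.
Proof.
move=> i2 J0.
have I0 : (\int[P]_x `|(X x ^+ 2 * 1)%:E| = 0)%E.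
  rewrite (eq_integral (fun x => (X x ^+ 2 * 1)%:E)); last first.
    by move=> x _; rewrite gee0_abs// lee_fin mulr1 sqr_ge0.
  rewrite -[LHS]fineK; first by rewrite -[X in X%:E]/(J (fun x => x ^+ 2)) J0.
  exact: integrable_fin_num.
have [N [mN N0 XN]] := (ae_eq_integral_abs P measurableT (measurable_int P i2)).1 I0.
have mA : measurable [set w | X w = 0].
  by rewrite -[X in measurable X]setTI; exact: (mX measurableT (measurable_set1 0)).
have negl : P.-negligible (~` [set w | X w = 0]).
  exists N; split => // w /= Xw; apply: XN => /= /(_ I) [/eqP].
  by rewrite mulr1 sqrf_eq0 => /eqP.
have := probability_setC P (measurableC mA).
by rewrite setCK (measure_negligible (measurableC mA) negl) sube0.
Qed.

End CharfunMoments.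

(** * Identification of the moments of [X] and of its distribution *)

Theorem theorem2 (d : measure_display) (T : measurableType d) (R : realType)
  (P : probability T R) (X : {RV P >-> R}) (n : nat) (mu : 'I_n -> R) :
  (2 <= n)%N ->
  injective mu ->
  (forall k, 0 < mu k) ->
  csmooth_at0 (charfun X) ->
  (forall t : R, \prod_(k < n) charfun X (mu k * t) =
                 \sum_(k < n) (theta mu k)%:C%C * charfun X (mu k * t)) ->
  P [set w | X w = 0] = 1%E \/ is_laplace X.
Proof.
move=> n2 mu_inj mu_gt0 [us _] fE.
pose W1 : T -> R := fun=> 1.
pose J := wint P X W1.
have mX : measurable_fun [set: T] X by exact: measurable_funP.
have mw : measurable_fun [set: T] W1 by exact: measurable_cst.
have w0 x : 0 <= W1 x by exact: ler01.
have i1 : wintegrable P X W1 (fun=> 1) := wintegrable_RV_cst X.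
have {}us : smooth_at0 (fun t => J (fun x => cos (t * x))).
  by move: us; under eq_fun do rewrite charfunE.
have ipow j : wintegrable P X W1 (fun x => x ^+ j) by exact: wintegrable_pow.
(* Chosen so that [1 / (1 + c * t ^ 2)] and the characteristic function share the coefficient [- c]
   of [t ^ 2]. *)
pose c := J (fun x => x ^+ 2) / 2.
have c0 : 0 <= c by rewrite divr_ge0// wint_ge0// => x; exact: sqr_ge0.
have fX N : bigO0 N (fun t => charfun X t - \sum_(j < N) char_coef P X W1 j * t%:C%C ^+ j).
  by under eq_fun do rewrite charfunE; exact: wint_cos_sin_expansion.
have coefE := functional_eq_unique n2 mu_inj mu_gt0 fE
  (fun t => cauchy_functional_eq n2 mu_inj mu_gt0 t c0) fX
  (b := fun j => (if odd j then 0 else (- c) ^+ j./2)%:C%C) (cauchy_expansion c0).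
have {}coefE : char_coef P X W1 =1 (fun j => (if odd j then 0 else (- c) ^+ j./2)%:C%C).
  apply: coefE.
  - rewrite /char_coef/= expr0 mul1r fact0 divr1 mulr1.
    by under [X in wint _ _ _ X]eq_fun do rewrite expr0; rewrite wint_RV_cst.
  - by rewrite /= expr0.
  - by rewrite /char_coef/= mulr1 !expr1 /c -/J mulN1r mulNr.
have Jeven k : J (fun x => x ^+ k.*2) = (k.*2)`!%:R * c ^+ k.
  have := coefE k.*2; rewrite /char_coef odd_double mulr1 doubleK -/J => /complexI.
  rewrite -mulrA (exprNn c) => /(mulfI (negbT (signr_eq0 _ _))) <-.
  by rewrite mulrC divfK// pnatr_eq0 -lt0n fact_gt0.
have Jodd k : J (fun x => x ^+ k.*2.+1) = 0.
  have := coefE k.*2.+1; rewrite /char_coef oddS odd_double/= uphalf_double -/J.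
  (* Odd coefficients are ['i] times a real number, so the moment is read off the imaginary part. *)
  move=> /(congr1 (@complex.Im R)) /=; rewrite mulr1 mul0r addr0 => /eqP.
  by rewrite !mulf_eq0 signr_eq0 invr_eq0 pnatr_eq0 (gtn_eqF (fact_gt0 _)) orbF => /eqP.
have [c_eq0|c_neq0] := eqVneq c 0.
  by left; apply: RV_eq0 => //; have := Jeven 1; rewrite c_eq0 expr1 mulr0.
have c_gt0 : 0 < c by rewrite lt_def c_neq0.
(* The Laplace law with this parameter has second moment [2 / l ^ 2 = 2 * c], that of [X]. *)
right; pose l := (Num.sqrt c)^-1.
have l0 : 0 < l by rewrite invr_gt0 sqrtr_gt0.
have lc : l^-1 ^+ 2 = c by rewrite invrK sqr_sqrtr.
exists l; split => // b.
have Jl k : (k.*2)`!%:R / l ^+ k.*2 = (k.*2)`!%:R * c ^+ k.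
  by rewrite -exprVn -mul2n exprM lc.
have wpow j : weq P lebesgue_measure X W1 (fun y : measurableTypeR R => y) (laplace_pdf l) (fun x => x ^+ j).
  split => //; first exact: wintegrable_pow_laplace.
  have [k [->|->]] : exists k, j = k.*2 \/ j = k.*2.+1.
    by exists j./2; rewrite -{1 3}(odd_double_half j); case: odd; [right|left].
  - by rewrite laplace_moment_even// Jl -Jeven.
  - by rewrite laplace_moment_odd// -[LHS]/(J _) Jodd.
have mom k : J (fun x => x ^+ k.*2) <= (k.*2)`!%:R * l^-1 ^+ k.*2.
  by rewrite Jeven -mul2n exprM lc.
have linv0 : 0 < l^-1 by rewrite invr_gt0.
have [_ _ ig e] := weq_gt mX mw (@measurable_idR R) (@measurable_laplace_pdf R l) w0
  (laplace_pdf_ge0 l0) linv0 wpow mom b.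
rewrite -wint_RV_gt e /wint /Rintegral fineK; last exact: integrable_fin_num.
rewrite -ge0_integralZl_EFin//; last 2 first.
- apply/measurable_EFinP; apply: measurable_funTS.
  by apply: continuous_measurable_fun; exact: continuous_expRN_abs.
- by rewrite divr_ge0// ltW.
rewrite [RHS]integral_mkcond; apply: eq_integral => y _.
rewrite patchE mem_setE in_itv/= andbT.
by case: (b < y); rewrite ?mul1r ?mul0r -?EFinM.
Qed.
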